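(* Let $n\ge 1$ and let $\Gamma$ be either $\Sigma_n$ or $\Pi_n$. There exist an infinite r.e. family $\{T_i\}_{i\in\omega}$ of theories and a theory $U$ satisfying the following two conditions: (1) there exists a set $X\subseteq\omega$ such that $$\bigcap_{i\in\omega\setminus X}\mathrm{Th}_{\Gamma^d}(T_i)\nsubseteq \mathrm{Th}\Bigl(U+\bigcup_{i\in X}\mathrm{Th}_\Gamma(T_i)\Bigr);$$ (2) there is no r.e. set $X\subseteq\omega$ such that $$\bigcap_{i\in\omega\setminus X}\mathrm{Th}_{\Gamma^d}(T_i)\nsubseteq \mathrm{Th}\Bigl(U+\bigcup_{i\in X}\mathrm{Th}_\Gamma(T_i)\Bigr).$$
   Context: $\mathsf{PA}$ is Peano Arithmetic. A ''theory'' means a recursively enumerable (r.e.) consistent extension of $\mathsf{PA}$ in the language of $\mathsf{PA}$. An infinite r.e. family of theories $\{T_i\}_{i\in\omega}$ is a sequence of theories with $T_i$ uniformly r.e. in $i$. For $n\ge1$, $\Sigma_n$ and $\Pi_n$ are the usual classes of formulas of the arithmetical hierarchy (over bounded, i.e. $\Delta_0$, formulas), with closure properties used up to $\mathsf{PA}$-provable equivalence. Put $\Sigma_n^d=\Pi_n$ and $\Pi_n^d=\Sigma_n$. For a set $T$ of axioms (possibly inconsistent), $\mathrm{Th}(T)$ is the set of all sentences provable from $T$, and for a class $\Lambda$ of formulas, $\mathrm{Th}_\Lambda(T)$ is the set of all $\Lambda$ sentences provable from $T$. By convention, $\bigcap_{i\in\emptyset}\mathrm{Th}_{\Gamma^d}(T_i)$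 is the set of all sentences. *)

(* Defs.v *)
From Stdlib Require Cantor.
From mathcomp Require Import all_boot.
From mathcomp Require Import classical_sets.

Set Implicit Arguments.
Unset Strict Implicit.
Unset Printing Implicit Defensive.

Local Open Scope classical_set_scope.

(** * Recursively enumerable sets *)

Definition npair (x y : nat) : nat := Cantor.to_nat (x, y).
Definition nfst (x : nat) : nat := (Cantor.of_nat x).1.
Definition nsnd (x : nat) : nat := (Cantor.of_nat x).2.

(* Kleene's partial recursive functions.  All functions are unary; several
   arguments are passed through the Cantor pairing. *)
Inductive code : Type :=
| c_zero
| c_succ
| c_fst
| c_snd
| c_pair of code & code
| c_comp of code & code
| c_prec of code & code
| c_min of code.

(* [eval c x y]: the function coded by [c] is defined at [x], with value [y]. *)
Fixpoint eval (c : code) (x y : nat) {struct c} : Prop :=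
  match c with
  | c_zero => y = 0
  | c_succ => y = x.+1
  | c_fst => y = nfst x
  | c_snd => y = nsnd x
  | c_pair f g => exists a b, [/\ eval f x a, eval g x b & y = npair a b]
  | c_comp f g => exists2 a, eval g x a & eval f a y
  | c_prec f g =>
      (fix rec (m r : nat) {struct m} : Prop :=
         match m with
         | 0 => eval f (nfst x) r
         | m'.+1 =>
             exists2 r', rec m' r' & eval g (npair (nfst x) (npair m' r')) r
         end) (nsnd x) y
  | c_min f =>
      eval f (npair x y) 0 /\
      (forall z, z < y -> exists w, eval f (npair x z) w.+1)
  end.

Definition re (X : set nat) : Prop :=
  exists c : code, forall x, X x <-> exists y, eval c x y.

(** * First-order arithmetic *)

(* Variables are de Bruijn indices.  The language is {0, S, +, *, <} with
   equality; [Bot], [Imp] and [All] are the primitive logical symbols. *)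
Inductive term : Type :=
| Var of nat
| Zero
| Succ of term
| Add of term & term
| Mul of term & term.

Inductive form : Type :=
| Bot
| Eq of term & term
| Lt of term & term
| Imp of form & form
| All of form.

Definition Neg (p : form) : form := Imp p Bot.
Definition And (p q : form) : form := Neg (Imp p (Neg q)).
Definition Or (p q : form) : form := Imp (Neg p) q.
Definition Iff (p q : form) : form := And (Imp p q) (Imp q p).
Definition Ex (p : form) : form := Neg (All (Neg p)).

Fixpoint tsubst (s : nat -> term) (t : term) : term :=
  match t with
  | Var i => s i
  | Zero => Zero
  | Succ t => Succ (tsubst s t)
  | Add t u => Add (tsubst s t) (tsubst s u)
  | Mul t u => Mul (tsubst s t) (tsubst s u)
  end.

Definition tshift : term -> term := tsubst (fun i => Var i.+1).

Definition scons (t : term) (s : nat -> term) (i : nat) : term :=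
  if i is j.+1 then s j else t.

Definition up (s : nat -> term) : nat -> term :=
  scons (Var 0) (fun i => tshift (s i)).

Fixpoint fsubst (s : nat -> term) (p : form) : form :=
  match p with
  | Bot => Bot
  | Eq t u => Eq (tsubst s t) (tsubst s u)
  | Lt t u => Lt (tsubst s t) (tsubst s u)
  | Imp p q => Imp (fsubst s p) (fsubst s q)
  | All p => All (fsubst (up s) p)
  end.

Definition fshift : form -> form := fsubst (fun i => Var i.+1).
Definition inst (p : form) (t : term) : form := fsubst (scons t Var) p.

(* [tbound k t], [fbound k p]: all free variables have index below [k]. *)
Fixpoint tbound (k : nat) (t : term) : bool :=
  match t with
  | Var i => i < k
  | Zero => true
  | Succ t => tbound k t
  | Add t u | Mul t u => tbound k t && tbound k u
  end.

Fixpoint fbound (k : nat) (p : form) : bool :=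
  match p with
  | Bot => true
  | Eq t u | Lt t u => tbound k t && tbound k u
  | Imp p q => fbound k p && fbound k q
  | All p => fbound k.+1 p
  end.

Definition sentence : set form := [set p | fbound 0 p].

(* Hilbert-style classical first-order logic with equality.  [prv_gen] is
   sound because it is only used with sets [T] of sentences. *)
Inductive prv (T : set form) : form -> Prop :=
| prv_ax p : T p -> prv T p
| prv_K p q : prv T (Imp p (Imp q p))
| prv_S p q r :
    prv T (Imp (Imp p (Imp q r)) (Imp (Imp p q) (Imp p r)))
| prv_DN p : prv T (Imp (Neg (Neg p)) p)
| prv_inst p t : prv T (Imp (All p) (inst p t))
| prv_dist p q : prv T (Imp (All (Imp p q)) (Imp (All p) (All q)))
| prv_vac p : prv T (Imp p (All (fshift p)))
| prv_refl t : prv T (Eq t t)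
| prv_leibniz p t u : prv T (Imp (Eq t u) (Imp (inst p t) (inst p u)))
| prv_mp p q : prv T (Imp p q) -> prv T p -> prv T q
| prv_gen p : prv T p -> prv T (All p).

Definition Th (T : set form) : set form := [set p | sentence p /\ prv T p].

Definition ThC (L T : set form) : set form := L `&` Th T.

(** * Peano arithmetic *)

Definition induction (p : form) : form :=
  Imp (inst p Zero)
    (Imp (All (Imp p (fsubst (fun i => if i is j.+1 then Var j.+1
                                       else Succ (Var 0)) p)))
         (All p)).

(* The parameters of an induction axiom are bound by an arbitrary number of
   outer universal quantifiers that makes it a sentence. *)
Inductive PA : set form :=
| PA_succ_neq0 : PA (All (Neg (Eq (Succ (Var 0)) Zero)))
| PA_succ_inj :
    PA (All (All (Imp (Eq (Succ (Var 1)) (Succ (Var 0)))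
                      (Eq (Var 1) (Var 0)))))
| PA_add0 : PA (All (Eq (Add (Var 0) Zero) (Var 0)))
| PA_addS :
    PA (All (All (Eq (Add (Var 1) (Succ (Var 0)))
                     (Succ (Add (Var 1) (Var 0))))))
| PA_mul0 : PA (All (Eq (Mul (Var 0) Zero) Zero))
| PA_mulS :
    PA (All (All (Eq (Mul (Var 1) (Succ (Var 0)))
                     (Add (Mul (Var 1) (Var 0)) (Var 1)))))
| PA_lt0 : PA (All (Neg (Lt (Var 0) Zero)))
| PA_ltS :
    PA (All (All (Iff (Lt (Var 1) (Succ (Var 0)))
                      (Or (Lt (Var 1) (Var 0)) (Eq (Var 1) (Var 0))))))
| PA_induction k p :
    sentence (iter k All (induction p)) -> PA (iter k All (induction p)).

(** * The arithmetical hierarchy *)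

(* The bound [t] of the quantifier does not contain the quantified variable.
   The bounded existential quantifier is the dual
   [Neg (ball t (Neg p))]. *)
Definition ball (t : term) (p : form) : form :=
  All (Imp (Lt (Var 0) (tshift t)) p).

Inductive Delta0 : set form :=
| Delta0_Bot : Delta0 Bot
| Delta0_Eq t u : Delta0 (Eq t u)
| Delta0_Lt t u : Delta0 (Lt t u)
| Delta0_Imp p q : Delta0 p -> Delta0 q -> Delta0 (Imp p q)
| Delta0_ball t p : Delta0 p -> Delta0 (ball t p).

Inductive kind : Type := Sigma | Pi.

Definition dual (G : kind) : kind := if G is Sigma then Pi else Sigma.

Definition quant (G : kind) : form -> form := if G is Sigma then Ex else All.

(* [hier Sigma n] is Sigma_n and [hier Pi n] is Pi_n, in strict prenex form:
   a formula of [hier G n.+1] is a formula of [hier (dual G) n] preceded by a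
   possibly empty block of quantifiers [quant G].  The other usual members of
   the classes are PA-provably equivalent to one of these. *)
Inductive hier : kind -> nat -> set form :=
| hier_Delta0 G p : Delta0 p -> hier G 0 p
| hier_dual G n p : hier (dual G) n p -> hier G n.+1 p
| hier_quant G n p : hier G n.+1 p -> hier G n.+1 (quant G p).

(** * Theories *)

Fixpoint tgodel (t : term) : nat :=
  match t with
  | Var i => npair 0 i
  | Zero => npair 1 0
  | Succ t => npair 2 (tgodel t)
  | Add t u => npair 3 (npair (tgodel t) (tgodel u))
  | Mul t u => npair 4 (npair (tgodel t) (tgodel u))
  end.

Fixpoint godel (p : form) : nat :=
  match p with
  | Bot => npair 0 0
  | Eq t u => npair 1 (npair (tgodel t) (tgodel u))
  | Lt t u => npair 2 (npair (tgodel t) (tgodel u))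
  | Imp p q => npair 3 (npair (godel p) (godel q))
  | All p => npair 4 (godel p)
  end.

Record theory (T : set form) : Prop := Theory {
  theory_sentence : T `<=` sentence;
  theory_re : re [set godel p | p in T];
  theory_PA : Th PA `<=` Th T;
  theory_consistent : ~ prv T Bot
}.

(* An infinite r.e. family is a sequence indexed by all of nat; its members
   are not required to be distinct. *)
Record re_family (T : nat -> set form) : Prop := ReFamily {
  re_family_theory : forall i, theory (T i);
  re_family_uniform :
    re [set x | exists i p, T i p /\ x = npair i (godel p)]
}.

(* Intersecting with [sentence] only matters for [X = setT], where the empty
   intersection is the set of all sentences. *)
Definition common (L : set form) (T : nat -> set form) (X : set nat) :
    set form :=
  sentence `&` \bigcap_(i in ~` X) ThC L (T i).

(* Main.v *)
Require Import Defs.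
From mathcomp Require Import all_boot.
From mathcomp Require Import classical_sets.
From mathcomp Require Import boolp zify.

Set Implicit Arguments.
Unset Strict Implicit.
Unset Printing Implicit Defensive.

Local Open Scope classical_set_scope.

(** The whole family is built from two Sigma_1 sentences and one r.e. set.

    Let [Ex p] and [Ex q], with [p] and [q] bounded, be incomparable over PA:
    both PA + [Ex p] + ~[Ex q] and PA + [Ex q] + ~[Ex p] are consistent.  Let
    [A] be an r.e. set whose complement is not r.e.  Put T_i = PA + [Ex p] +
    ~[Ex q] for i in [A], T_i = PA for i outside [A], and U = PA + [Ex q] +
    ~[Ex p].  Write ~[Ex q] as [All (Neg q)].  One of [Ex p], [All (Neg q)]
    is in Gamma and the other in the dual class, for each Gamma and every
    level n >= 1, and U refutes both of them.

    - The complement X of [A] separates the two sides: the theories T_i with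
      i in [A] share a theorem of the dual class that U refutes, while the
      T_i with i in X add nothing to U.
    - No r.e. X does.  If X meets [A], then U together with the Gamma
      theorems of the T_i, i in X, is inconsistent and proves every sentence.
      If X is disjoint from [A], then X is not the whole complement of [A],
      so that T_i = PA for some i outside X; every common theorem is then a
      theorem of PA, hence of U.

    The incomparable sentences come from a diagonal argument that uses nothing
    about PA except that it is r.e. and true in the standard model.  For a
    code m of a pair (p, q) of formulas, search for a proof that p(m) implies
    q(m) and for a proof that q(m) implies p(m); let P and Q be the sets of
    the m for which the first, respectively the second, is found first.  They
    are disjoint and definable by formulas [Ex p] and [Ex q] with bounded [p]
    and [q] ([Sigma1_reduction]).  Take for m the code of this very pair.  If
    m is in P, then p(m) is true and PA proves that p(m) implies q(m), so
    q(m) is true and m is in Q as well; symmetrically if m is in Q.  Hence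
    neither proof exists ([incomparable_Sigma1]).

    The set [A] is the halting set of Kleene's codes.

    What remains is to show that provability and evaluation are r.e.  Both are
    inductively defined, as are the syntactic operations on Goedel numbers, so
    all of this rests on one lemma, [Sigma1_least]: a set generated by Sigma_1
    rules is Sigma_1.  Derivations are coded by Goedel's beta function, and
    Sigma_1 sets are enumerated by Kleene codes ([Sigma1_re]). *)

(** * Truth in the standard model *)

Definition env := nat -> nat.

Definition ncons (a : nat) (e : env) : env := fun i => if i is j.+1 then e j else a.

Fixpoint teval (e : env) (t : term) : nat :=
  match t with
  | Var i => e i
  | Zero => 0
  | Succ t => (teval e t).+1
  | Add t u => teval e t + teval e u
  | Mul t u => teval e t * teval e u
  end.

Fixpoint sat (e : env) (p : form) : Prop :=
  match p with
  | Bot => False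
  | Eq t u => teval e t = teval e u
  | Lt t u => teval e t < teval e u
  | Imp p q => sat e p -> sat e q
  | All p => forall a, sat (ncons a e) p
  end.

Lemma teval_subst e s t : teval e (tsubst s t) = teval (fun i => teval e (s i)) t.
Proof. by elim: t => //= [t -> | t -> u -> | t -> u ->]. Qed.

Lemma teval_shift a e t : teval (ncons a e) (tshift t) = teval e t.
Proof. by rewrite teval_subst. Qed.

Lemma ncons_up a e s :
  (fun i => teval (ncons a e) (up s i)) = ncons a (fun i => teval e (s i)).
Proof. by apply: funext => -[|i] //=; rewrite teval_shift. Qed.

Lemma sat_subst e s p : sat e (fsubst s p) = sat (fun i => teval e (s i)) p.
Proof.
elim: p e s => //= [t u|t u|p IHp q IHq|p IHp] e s; rewrite ?teval_subst //.
  by rewrite IHp IHq.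
by apply: eq_forall => a; rewrite IHp ncons_up.
Qed.

Lemma sat_inst e p t : sat e (inst p t) = sat (ncons (teval e t) e) p.
Proof. by rewrite /inst sat_subst; congr sat; apply: funext => -[]. Qed.

Lemma sat_shift a e p : sat (ncons a e) (fshift p) = sat e p.
Proof. by rewrite /fshift sat_subst. Qed.

Lemma sat_Ex e p : sat e (Ex p) <-> exists a, sat (ncons a e) p.
Proof.
split=> /= [/existsNP[a /contrapT]|[a pa]]; first by exists a.
by move=> /(_ a).
Qed.

Lemma sat_ball e t p :
  sat e (ball t p) <-> forall a, a < teval e t -> sat (ncons a e) p.
Proof. by split=> /= h a; have := h a; rewrite teval_shift. Qed.

(** The bounded existential quantifier that corresponds to [ball]. *)
Definition bex (t : term) (p : form) : form := Neg (ball t (Neg p)).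

Lemma sat_bex e t p :
  sat e (bex t p) <-> exists a, a < teval e t /\ sat (ncons a e) p.
Proof.
rewrite -[sat e _]/(~ sat e (ball t (Neg p))) sat_ball; split.
  by move=> /existsNP[a /not_implyP[? /contrapT ?]]; exists a.
by case=> a [la pa] h; exact: h a la pa.
Qed.

Theorem soundness T p :
  (forall e q, T q -> sat e q) -> prv T p -> forall e, sat e p.
Proof.
move=> soundT; elim=> {p} //=.
- by move=> p Tp e; apply: soundT.
- by move=> p q r e h1 h2 h3; apply: h1 => //; apply: h2.
- by move=> p e; apply: contrapT.
- by move=> p t e h; rewrite sat_inst.
- by move=> p q e h1 h2 a; apply: h1.
- by move=> p e h a; rewrite sat_shift.
- by move=> p t u e; rewrite !sat_inst => ->.
- by move=> p q _ IHpq _ IHp e; apply: IHpq.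
Qed.

Lemma sat_iter_All k p : (forall e, sat e p) -> forall e, sat e (iter k All p).
Proof. by move=> h; elim: k => //= k IHk e a. Qed.

(** Induction in PA holds because the standard model satisfies induction for
    arbitrary predicates. *)
Lemma PA_true e p : PA p -> sat e p.
Proof.
case=> {p} /=; try by move=> *; lia.
move=> k p _; apply: sat_iter_All => {}e; rewrite /= sat_inst => p0 pS a.
elim: a => // a /pS; rewrite sat_subst; congr sat.
by apply: funext => -[].
Qed.
(** * Sigma_1 predicates *)

Lemma tshift_subst s t : tsubst (up s) (tshift t) = tshift (tsubst s t).
Proof.
rewrite /tshift; elim: t => //= [t -> | t -> u -> | t -> u ->] //.
Qed.

Lemma Delta0_subst s p : Delta0 p -> Delta0 (fsubst s p).
Proof.
move=> d; elim: d s => {p}; try by constructor.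
by move=> t p _ IHp s /=; rewrite tshift_subst; apply: Delta0_ball.
Qed.

Lemma Delta0_Neg p : Delta0 p -> Delta0 (Neg p).
Proof. by move=> ?; apply: Delta0_Imp => //; apply: Delta0_Bot. Qed.

Lemma Delta0_And p q : Delta0 p -> Delta0 q -> Delta0 (And p q).
Proof. by move=> ? ?; apply/Delta0_Neg/Delta0_Imp => //; apply: Delta0_Neg. Qed.

Lemma Delta0_bex t p : Delta0 p -> Delta0 (bex t p).
Proof. by move=> ?; apply/Delta0_Neg/Delta0_ball/Delta0_Neg. Qed.

Lemma sat_And e p q : sat e (And p q) <-> sat e p /\ sat e q.
Proof. by split=> /=; [move=> /not_implyP[? /contrapT] | case=> ? ?; apply]. Qed.

Definition ren (r : nat -> nat) (p : form) : form := fsubst (fun i => Var (r i)) p.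

Lemma sat_ren e r p : sat e (ren r p) = sat (fun i => e (r i)) p.
Proof. exact: sat_subst. Qed.

Lemma Delta0_ren r p : Delta0 p -> Delta0 (ren r p).
Proof. exact: Delta0_subst. Qed.

(** A single unbounded quantifier suffices: a bound on all witnesses at once can
    always be quantified in front, which is what the closure lemmas below do. *)
Definition Sigma1 (P : env -> Prop) : Prop :=
  exists2 p, Delta0 p & forall e, P e <-> exists b, sat (ncons b e) p.

Lemma Sigma1_ext (P Q : env -> Prop) :
  (forall e, P e <-> Q e) -> Sigma1 P -> Sigma1 Q.
Proof. by move=> PQ [p dp pP]; exists p => // e; rewrite -PQ. Qed.

Lemma Sigma1_sat p : Delta0 p -> Sigma1 (fun e => sat e p).
Proof.
move=> dp; exists (ren S p); first exact: Delta0_ren.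
by move=> e; split=> [h|[b]]; [exists 0|]; rewrite sat_ren.
Qed.

(** Renaming that makes room for one new variable below variable 0. *)
Definition skip1 (i : nat) : nat := if i is j.+1 then j.+2 else 0.
Definition swap01 (i : nat) : nat :=
  match i with 0 => 1 | 1 => 0 | _ => i end.

Lemma ncons_skip1 a b e : (fun i => ncons a (ncons b e) (skip1 i)) = ncons a e.
Proof. by apply: funext => -[|[]]. Qed.

Lemma Sigma1_ren r P : Sigma1 P -> Sigma1 (fun e => P (fun i => e (r i))).
Proof.
move=> [p dp pP]; exists (ren (fun i => if i is j.+1 then (r j).+1 else 0) p).
  exact: Delta0_ren.
move=> e; rewrite pP; split=> -[b]; rewrite ?sat_ren => h; exists b;
  rewrite ?sat_ren; move: h; congr sat; apply: funext => -[] //.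
Qed.

(** The two leading quantifiers merge into one that bounds both witnesses. *)
Lemma Sigma1_and P Q : Sigma1 P -> Sigma1 Q -> Sigma1 (fun e => P e /\ Q e).
Proof.
move=> [p dp pP] [q dq qQ].
exists (And (bex (Var 0) (ren skip1 p)) (bex (Var 0) (ren skip1 q))).
  by apply: Delta0_And; apply/Delta0_bex/Delta0_ren.
move=> e; rewrite pP qQ; split=> [[[b pb] [c qc]]|[d]].
  exists (b + c).+1; rewrite sat_And !sat_bex; split.
    by exists b; rewrite sat_ren ncons_skip1 ltnS leq_addr.
  by exists c; rewrite sat_ren ncons_skip1 ltnS leq_addl.
rewrite sat_And !sat_bex => -[[b []]]; rewrite sat_ren ncons_skip1 => _ ? [c []].
by rewrite sat_ren ncons_skip1 => _ ?; split; [exists b|exists c].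
Qed.

Lemma Sigma1_or P Q : Sigma1 P -> Sigma1 Q -> Sigma1 (fun e => P e \/ Q e).
Proof.
move=> [p dp pP] [q dq qQ]; exists (Or p q).
  by apply: Delta0_Imp => //; apply: Delta0_Neg.
move=> e; rewrite pP qQ; split=> [[[b h]|[b h]]|[b /= h]].
- by exists b => /= /(_ h).
- by exists b.
have [?|/h ?] := EM (sat (ncons b e) p); first by left; exists b.
by right; exists b.
Qed.

Lemma Sigma1_ex (P : nat -> env -> Prop) :
  Sigma1 (fun e => P (e 0) (fun i => e i.+1)) -> Sigma1 (fun e => exists x, P x e).
Proof.
move=> [p dp pP].
exists (bex (Var 0) (bex (Var 1) (ren (fun i => if i is j.+2 then j.+3 else i) p))).
  by apply/Delta0_bex/Delta0_bex/Delta0_ren.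
have E x b c e : (fun i => ncons b (ncons x (ncons c e))
    (if i is j.+2 then j.+3 else i)) = ncons b (ncons x e).
  by apply: funext => -[|[|[]]].
move=> e; split=> [[x] | [c]].
  move=> /(pP (ncons x e)) [b h]; exists (x + b).+1; rewrite sat_bex.
  exists x; split; first by rewrite /= ltnS leq_addr.
  by rewrite sat_bex; exists b; rewrite sat_ren E /= ltnS leq_addl.
rewrite sat_bex => -[x [_]]; rewrite sat_bex => -[b []]; rewrite sat_ren E => _ h.
by exists x; apply/(pP (ncons x e)); exists b.
Qed.

(** The collection principle, which holds in the standard model because finitely
    many witnesses have a common bound. *)
Lemma bounded_choice (R : nat -> nat -> Prop) n :
  (forall i, i < n -> exists b, R i b) ->
  exists c, forall i, i < n -> exists b, b < c /\ R i b.
Proof.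
elim: n => [|n IHn] h; first by exists 0.
have [c hc] := IHn (fun i li => h i (ltnW li)).
have [b Rb] := h n (ltnSn n).
exists (c + b.+1) => i; rewrite ltnS leq_eqVlt => /orP[/eqP->|/hc[d [ld Rd]]].
  by exists b; split=> //; lia.
by exists d; split=> //; lia.
Qed.

(** By collection, [forall x < k, exists b] becomes
    [exists c, forall x < k, exists b < c]. *)
Lemma Sigma1_ball_var (P : nat -> env -> Prop) k :
  Sigma1 (fun e => P (e 0) (fun i => e i.+1)) ->
  Sigma1 (fun e => forall x, x < e k -> P x e).
Proof.
move=> [p dp pP].
exists (ball (Var k.+1) (bex (Var 1) (ren (fun i => if i is j.+2 then j.+3 else i) p))).
  by apply/Delta0_ball/Delta0_bex/Delta0_ren.
have E x b c e : (fun i => ncons b (ncons x (ncons c e))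
    (if i is j.+2 then j.+3 else i)) = ncons b (ncons x e).
  by apply: funext => -[|[|[]]].
move=> e; split=> [h | [c]].
  have {}h x : x < e k -> exists b, sat (ncons b (ncons x e)) p.
    by move=> /h /(pP (ncons x e)).
  have [c hc] := bounded_choice h; exists c; rewrite sat_ball => x /hc [b [lb sb]].
  by rewrite sat_bex; exists b; rewrite sat_ren E.
rewrite sat_ball => h x /h; rewrite sat_bex => -[b []]; rewrite sat_ren E => _ {}h.
by apply/(pP (ncons x e)); exists b.
Qed.

(** * Sigma_1 functions *)

(** Functions of the environment with a Sigma_1 graph; they are the terms that
    may be substituted into Sigma_1 predicates. *)
Definition Fn (f : env -> nat) : Prop := Sigma1 (fun e => e 0 = f (fun i => e i.+1)).

Lemma Sigma1_eq f g : Fn f -> Fn g -> Sigma1 (fun e => f e = g e).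
Proof.
move=> Ff Fg.
apply: (@Sigma1_ext (fun e => exists x, x = f e /\ x = g e)).
  by move=> e; split=> [[x [-> ]]|<-] //; exists (f e).
by apply: Sigma1_ex; apply: Sigma1_and.
Qed.

Definition Sigma1_set (C : nat -> Prop) : Prop := Sigma1 (fun e => C (e 0)).

Lemma Sigma1_mem C f : Sigma1_set C -> Fn f -> Sigma1 (fun e => C (f e)).
Proof.
move=> SC Ff.
apply: (@Sigma1_ext (fun e => exists x, x = f e /\ C x)).
  by move=> e; split=> [[x [-> ]]|?] //; exists (f e).
by apply: Sigma1_ex; apply: Sigma1_and.
Qed.

Lemma Sigma1_ball (P : nat -> env -> Prop) f :
  Fn f -> Sigma1 (fun e => P (e 0) (fun i => e i.+1)) ->
  Sigma1 (fun e => forall x, x < f e -> P x e).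
Proof.
move=> Ff SP.
apply: (@Sigma1_ext (fun e => exists y, y = f e /\ forall x, x < y -> P x e)).
  by move=> e; split=> [[x [-> ]]|?] //; exists (f e).
apply: Sigma1_ex; apply: Sigma1_and => //.
apply: (@Sigma1_ball_var (fun x e => P x (fun i => e i.+1)) 0).
exact: (Sigma1_ren skip1 SP).
Qed.

Lemma Fn_term t : Fn (fun e => teval e t).
Proof.
have := Sigma1_sat (Delta0_Eq (Var 0) (tshift t)).
by apply: Sigma1_ext => e /=; rewrite teval_subst.
Qed.

Lemma Fn_var i : Fn (fun e => e i). Proof. exact: (Fn_term (Var i)). Qed.

Lemma Fn_const n : Fn (fun=> n).
Proof.
have := Fn_term (iter n Succ Zero).
suff -> : (fun e => teval e (iter n Succ Zero)) = (fun=> n) by [].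
by apply: funext => e; elim: n => //= n ->.
Qed.

Lemma Fn_comp1 (h : nat -> nat) f : Fn (fun e => h (e 0)) -> Fn f -> Fn (fun e => h (f e)).
Proof.
move=> Fh Ff.
apply: (@Sigma1_ext (fun e => exists x, x = f (fun i => e i.+1) /\ e 0 = h x)).
  by move=> e; split=> [[x [-> ]]|?] //; exists (f (fun i => e i.+1)).
apply: Sigma1_ex; apply: Sigma1_and; first exact: (Sigma1_ren skip1 Ff).
exact: (Sigma1_ren swap01 Fh).
Qed.

Lemma Fn_comp2 (h : nat -> nat -> nat) f g :
  Fn (fun e => h (e 0) (e 1)) -> Fn f -> Fn g -> Fn (fun e => h (f e) (g e)).
Proof.
move=> Fh Ff Fg.
apply: (@Sigma1_ext (fun e => exists x y, [/\ x = f (fun i => e i.+1),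
    y = g (fun i => e i.+1) & e 0 = h x y])).
  move=> e; split=> [[x [y [-> ->]]]|?] //.
  by exists (f (fun i => e i.+1)), (g (fun i => e i.+1)).
apply: (@Sigma1_ext (fun e => exists x y, x = f (fun i => e i.+1) /\
    (y = g (fun i => e i.+1) /\ e 0 = h x y))).
  by move=> e; split=> [[x [y [? [? ?]]]]|[x [y []]]]; exists x, y.
do 2!apply: Sigma1_ex; apply: Sigma1_and.
  exact: (Sigma1_ren (fun i => if i is j.+1 then j.+3 else 1) Ff).
apply: Sigma1_and.
  exact: (Sigma1_ren (fun i => if i is j.+1 then j.+3 else 0) Fg).
(* The graph of [h] has the order value, first argument, second argument; the
   context has the opposite one. *)
exact: (Sigma1_ren (subn 2) Fh).
Qed.

Lemma Sigma1_lt f g : Fn f -> Fn g -> Sigma1 (fun e => f e < g e).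
Proof.
move=> Ff Fg.
apply: (@Sigma1_ext (fun e => exists x, x = f e /\ exists y, y = g e /\ x < y)).
  move=> e; split=> [[x [-> [y [-> ]]]]|?] //.
  by exists (f e); split=> //; exists (g e).
apply: Sigma1_ex; apply: Sigma1_and => //; apply: Sigma1_ex; apply: Sigma1_and.
  exact: (Sigma1_ren skip1 Fg).
exact: (Sigma1_sat (Delta0_Lt (Var 1) (Var 0))).
Qed.

Lemma Fn_succ f : Fn f -> Fn (fun e => (f e).+1).
Proof. exact/(@Fn_comp1 S)/(Fn_term (Succ (Var 0))). Qed.

Lemma Fn_add f g : Fn f -> Fn g -> Fn (fun e => f e + g e).
Proof. exact/(@Fn_comp2 addn)/(Fn_term (Add (Var 0) (Var 1))). Qed.

Lemma Fn_mul f g : Fn f -> Fn g -> Fn (fun e => f e * g e).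
Proof. exact/(@Fn_comp2 muln)/(Fn_term (Mul (Var 0) (Var 1))). Qed.

Lemma npairE x y : npair x y * 2 = y * 2 + (y + x) * (y + x).+1.
Proof. exact: Cantor.to_nat_spec. Qed.

Lemma npairK1 x y : nfst (npair x y) = x.
Proof. by rewrite /nfst /npair Cantor.cancel_of_to. Qed.

Lemma npairK2 x y : nsnd (npair x y) = y.
Proof. by rewrite /nsnd /npair Cantor.cancel_of_to. Qed.

Lemma npair_inj x y x' y' : npair x y = npair x' y' -> x = x' /\ y = y'.
Proof. by move=> h; rewrite -(npairK1 x y) -{2}(npairK2 x y) h npairK1 npairK2. Qed.

Lemma nfst_snd x : npair (nfst x) (nsnd x) = x.
Proof. by rewrite /npair /nfst /nsnd -surjective_pairing Cantor.cancel_to_of. Qed.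

(** The Cantor pairing is quadratic up to the factor 2, hence its graph is a
    polynomial equation. *)
Lemma Fn_pair f g : Fn f -> Fn g -> Fn (fun e => npair (f e) (g e)).
Proof.
apply: (@Fn_comp2 npair).
apply: (@Sigma1_ext (fun e => e 0 * 2 = e 2 * 2 + (e 2 + e 1) * (e 2 + e 1).+1)).
  by move=> e; split=> [|->]; rewrite -npairE; lia.
exact: (Sigma1_sat (Delta0_Eq (Mul (Var 0) (Succ (Succ Zero)))
  (Add (Mul (Var 2) (Succ (Succ Zero)))
       (Mul (Add (Var 2) (Var 1)) (Succ (Add (Var 2) (Var 1))))))).
Qed.

(** The tactics [fn] and [sigma1] prove that an explicitly written function or
    predicate is Sigma_1 by following its syntax; the hint database [sigma1]
    contains the sets already known to be Sigma_1. *)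
Create HintDb sigma1.

Ltac fn :=
  lazymatch goal with
  | |- Fn (fun e => e _) => exact: Fn_var
  | |- Fn (fun e => npair _ _) => apply: Fn_pair; fn
  | |- Fn (fun e => S _) => first [exact: Fn_const | apply: Fn_succ; fn]
  | |- Fn (fun e => addn _ _) => apply: Fn_add; fn
  | |- Fn (fun e => muln _ _) => apply: Fn_mul; fn
  | |- Fn (fun _ => _) => exact: Fn_const
  end.

Ltac sigma1 :=
  cbv beta;
  lazymatch goal with
  | |- Sigma1 (fun e => _ /\ _) => apply: Sigma1_and; sigma1
  | |- Sigma1 (fun e => _ \/ _) => apply: Sigma1_or; sigma1
  | |- Sigma1 (fun e => exists x, _) => apply: Sigma1_ex; sigma1
  | |- Sigma1 (fun e => _ = _) => apply: Sigma1_eq; fn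
  | |- Sigma1 (fun e => is_true (leq (S _) _)) => apply: Sigma1_lt; fn
  | |- Sigma1 (fun e => forall x, is_true (leq (S x) _) -> _) =>
      apply: Sigma1_ball; [fn | sigma1]
  | |- Sigma1 (fun e => ?C (@?f e)) =>
      apply: (@Sigma1_mem C f); [solve [auto with sigma1 nocore] | fn]
  end.

(** * Inductively defined sets *)

(** Goedel's beta function: [v] is entry [i] of the sequence coded by [a] and
    [b]. *)
Definition beta (a b i v : nat) : Prop :=
  exists q, a = q * (b * i.+1).+1 + v /\ v < (b * i.+1).+1.

Lemma betaP a b i v : beta a b i v <-> v = a %% (b * i.+1).+1.
Proof.
split=> [[q [-> lv]]|->]; first by rewrite modnMDl modn_small.
by exists (a %/ (b * i.+1).+1); rewrite -divn_eq ltn_mod.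
Qed.

Lemma CRT_seq (m f : nat -> nat) n :
  (forall i j, i < j -> j < n -> coprime (m i) (m j)) ->
  exists a, forall i, i < n -> a = f i %[mod m i].
Proof.
elim: n => [|n IHn] co; first by exists 0.
have [a ha] := IHn (fun i j lij ljn => co i j lij (ltnW ljn)).
have co_n : coprime (\prod_(i < n) m i) (m n).
  by elim/big_rec: _ => [|i x _ cx]; rewrite ?coprime1n // coprimeMl co.
exists (chinese (\prod_(i < n) m i) (m n) a (f n)) => i.
rewrite ltnS leq_eqVlt => /orP[/eqP->|lin]; first exact: chinese_modr.
have dv : m i %| \prod_(i < n) m i.
  by rewrite (bigD1 (Ordinal lin)) //= dvdn_mulr.
by rewrite -(modn_dvdm _ dv) chinese_modl // modn_dvdm // ha.
Qed.

(** Let [b] be the factorial of a number that bounds the length and all entries.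
    The moduli [1 + b * (i + 1)] are pairwise coprime: a common divisor of two of
    them is prime to [b] and divides [b * (j - i)], so it divides [j - i], which
    divides [b]. *)
Lemma beta_exists (f : nat -> nat) n :
  exists a b, forall i, i < n -> beta a b i (f i).
Proof.
pose N := n + \max_(i < n) f i; pose b := N`!.
have co i j : i < j -> j < n -> coprime (b * i.+1).+1 (b * j.+1).+1.
  move=> lij ljn; rewrite /coprime; set d := gcdn _ _.
  have co_db : coprime d b.
    by apply: (coprime_dvdl (dvdn_gcdl _ _)); rewrite -addn1 coprime_sym
      /coprime gcdnC -gcdn_modl mulnC modnMDl gcdn_modl gcd1n.
  have : d %| b * (j - i).
    have -> : b * (j - i) = (b * j.+1).+1 - (b * i.+1).+1 by rewrite subSS -mulnBr subSS.
    by rewrite dvdn_subr ?dvdn_gcdl ?dvdn_gcdr // ltnS leq_mul2l ltnS ltnW ?orbT.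
  rewrite Gauss_dvdr // => d_ij.
  have d_b : d %| b by apply: (dvdn_trans d_ij); apply: dvdn_fact; rewrite /N; lia.
  by move: co_db; rewrite /coprime => /eqP <-; rewrite eq_sym; apply/eqP/gcdn_idPl.
have [a ha] := CRT_seq f co; exists a, b => i li.
apply/betaP; rewrite ha // modn_small // ltnS.
apply: (@leq_trans N); last first.
  by apply: (@leq_trans b); [exact: fact_geq | exact: leq_pmulr].
apply: leq_trans (leq_addl _ _).
exact: (@leq_bigmax _ (fun i : 'I_n => f i) (Ordinal li)).
Qed.

(** The least set that contains [B] and is closed under the two-premise rules
    [R conclusion premise premise].  A rule with one premise is expressed by
    ignoring the second one. *)
Inductive generated (B : nat -> Prop) (R : nat -> nat -> nat -> Prop) : nat -> Prop :=
| generated_base x : B x -> generated B R x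
| generated_rule x y z : R x y z -> generated B R y -> generated B R z -> generated B R x.

Definition justified B R (f : nat -> nat) (i : nat) : Prop :=
  B (f i) \/ exists j k, [/\ j < i, k < i & R (f i) (f j) (f k)].

(** Membership means that there is a finite derivation, a sequence in which
    every entry is an axiom or follows from earlier ones. *)
Lemma generated_derivation B R x :
  generated B R x <-> exists (f : nat -> nat) n,
    f n = x /\ forall i, i < n.+1 -> justified B R f i.
Proof.
split=> [|[f [n [<- jf]]]]; last first.
  suff h m i : i < m -> i < n.+1 -> generated B R (f i) by apply: (h n.+1).
  elim: m i => // m IHm i lim lin.
  case: (jf i lin) => [/generated_base //|[j [k [lj lk]]]].
  by move/generated_rule; apply; apply: IHm; lia.
elim=> {x} [x Bx|x y z Rx _ [f [m [fm jf]]] _ [g [n [gn jg]]]].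
  by exists (fun=> x), 0; split=> // i _; left.
(* Concatenate the derivations of the premises and append the conclusion. *)
pose h i := if i <= m then f i else if i <= m + n.+1 then g (i - m.+1) else x.
have hf i : i <= m -> h i = f i by rewrite /h => ->.
have hg i : i <= n -> h (m.+1 + i) = g i.
  by move=> ?; rewrite /h ifF ?ifT ?addKn; lia.
have hx : h (m + n.+1).+1 = x by rewrite /h ifF ?ifF; lia.
exists h, (m + n.+1).+1; split=> // i li; rewrite /justified.
have [lim|lmi] := leqP i m.
  rewrite hf //; case: (jf i lim) => [|[j [k [lj lk r]]]]; first by left.
  by right; exists j, k; rewrite !hf //; lia.
have [lin|lni] := leqP i (m + n.+1).
  have lin' : i - m.+1 < n.+1 by lia.
  rewrite -(subnKC lmi) hg //; case: (jg _ lin') => [|[j [k [lj lk r]]]]; first by left.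
  by right; exists (m.+1 + j), (m.+1 + k); rewrite !hg; [split=> //; lia|lia|lia].
right; have -> : i = (m + n.+1).+1 by lia.
by exists m, (m.+1 + n); rewrite hx hf // hg // fm gn; split=> //; lia.
Qed.

Lemma Sigma1_generated B R :
  Sigma1_set B -> Sigma1 (fun e => R (e 0) (e 1) (e 2)) -> Sigma1_set (generated B R).
Proof.
move=> SB SR.
have SP : Sigma1 (fun e => beta (e 0) (e 1) (e 2) (e 3)) by rewrite /beta; sigma1.
have SP' i j k l : Sigma1 (fun e => beta (e i) (e j) (e k) (e l)).
  by have := Sigma1_ren (fun m => nth 0 [:: i; j; k; l] m) SP.
have SR' i j k : Sigma1 (fun e => R (e i) (e j) (e k)).
  by have := Sigma1_ren (fun m => nth 0 [:: i; j; k] m) SR.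
apply: (@Sigma1_ext (fun e => exists a b n, beta a b n (e 0) /\
    forall i, i < n.+1 -> exists v, beta a b i v /\ (B v \/
      exists j k y z, j < i /\ k < i /\ beta a b j y /\ beta a b k z /\ R v y z))).
  move=> e; rewrite generated_derivation; split=> [[a [b [n [/betaP En h]]]]|[f [n [En h]]]].
    exists (fun i => a %% (b * i.+1).+1), n; split=> // i /h [v [/betaP -> []]].
      by left.
    move=> [j [k [y [z [lj [lk [/betaP -> [/betaP -> r]]]]]]]].
    by right; exists j, k.
  have [a [b ab]] := beta_exists f n.+1; exists a, b, n.
  rewrite -En; split; first exact: ab.
  move=> i li; exists (f i); split; first exact: ab.
  case: (h i li) => [|[j [k [lj lk r]]]]; first by left.
  right; exists j, k, (f j), (f k); do !split=> //; apply: ab; lia.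
have SB' := fun i => Sigma1_mem SB (Fn_var i).
do 3!apply: Sigma1_ex; apply: Sigma1_and; first exact: SP'.
apply: Sigma1_ball; first by fn.
apply: Sigma1_ex; apply: Sigma1_and; first exact: SP'.
apply: Sigma1_or; first exact: SB'.
do 4!apply: Sigma1_ex; apply: Sigma1_and; first by sigma1.
apply: Sigma1_and; first by sigma1.
by do 2!(apply: Sigma1_and; first exact: SP').
Qed.

(** The form in which sets of codes are shown to be Sigma_1.  The rules are
    about numbers and [W] about typed objects; the last two premises say that
    [W] is closed under the rules and that every member has a derivation. *)
Lemma Sigma1_least W B R :
  Sigma1_set B -> Sigma1 (fun e => R (e 0) (e 1) (e 2)) ->
  (forall x, B x -> W x) -> (forall x y z, R x y z -> W y -> W z -> W x) ->
  (forall x, W x -> generated B R x) -> Sigma1_set W.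
Proof.
move=> SB SR BW RW Wgen; apply: Sigma1_ext (Sigma1_generated SB SR) => e.
split=> [|/Wgen //]; elim=> [x /BW //|x y z r _ Wy _ Wz] //; apply: RW r Wy Wz.
Qed.

(** * Sigma_1 sets are recursively enumerable *)

Definition computable (f : nat -> nat) : Prop :=
  exists c, forall x y, eval c x y <-> y = f x.

Lemma computable_id : computable id.
Proof.
exists (c_pair c_fst c_snd) => x y; split=> [[a [b [-> -> ->]]]|->].
  exact: nfst_snd.
by exists (nfst x), (nsnd x); rewrite nfst_snd.
Qed.

Lemma computable_comp f g : computable f -> computable g -> computable (f \o g).
Proof.
move=> [c cP] [d dP]; exists (c_comp c d) => x y; split=> /=.
  by case=> a /dP -> /cP.
by move=> ->; exists (g x); [apply/dP | apply/cP].
Qed.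

Lemma computable_pair f g :
  computable f -> computable g -> computable (fun x => npair (f x) (g x)).
Proof.
move=> [c cP] [d dP]; exists (c_pair c d) => x y; split=> /=.
  by case=> a [b [/cP -> /dP -> ->]].
by move=> ->; exists (f x), (g x); split; [apply/cP | apply/dP |].
Qed.

Lemma computable_succ f : computable f -> computable (fun x => (f x).+1).
Proof. by apply: (@computable_comp S); exists c_succ. Qed.

Lemma computable_fst f : computable f -> computable (fun x => nfst (f x)).
Proof. by apply: (@computable_comp nfst); exists c_fst. Qed.

Lemma computable_snd f : computable f -> computable (fun x => nsnd (f x)).
Proof. by apply: (@computable_comp nsnd); exists c_snd. Qed.

Lemma computable_const n : computable (fun=> n).
Proof. by elim: n => [|n]; [exists c_zero | exact: computable_succ]. Qed.

(** Primitive recursion with a parameter [h x] and a bound [k x]; the two are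
    packed in a pair, as the codes expect. *)
Lemma computable_rec (F : nat -> nat) (G : nat -> nat -> nat -> nat) h k :
  computable F ->
  computable (fun x => G (nfst x) (nfst (nsnd x)) (nsnd (nsnd x))) ->
  computable h -> computable k ->
  computable (fun x => nat_rec (fun=> nat) (F (h x)) (G (h x)) (k x)).
Proof.
move=> [c cP] [d dP] ch ck.
pose rec x := nat_rec (fun=> nat) (F (nfst x)) (G (nfst x)) (nsnd x).
have crec : computable rec.
  exists (c_prec c d) => x y; rewrite /rec /=.
  elim: (nsnd x) y => [|m IHm] y /=; first exact: cP.
  split=> [[r /IHm -> /dP]|->]; first by rewrite npairK1 !npairK2 npairK1.
  set r := nat_rec _ _ _ _; exists r; first exact/IHm.
  by apply/dP; rewrite npairK1 !npairK2 npairK1.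
have := computable_comp crec (computable_pair ch ck).
by congr computable; apply: funext => x; rewrite /rec /= npairK1 npairK2.
Qed.

Lemma computable_add f g :
  computable f -> computable g -> computable (fun x => f x + g x).
Proof.
move=> cf cg.
have -> : (fun x => f x + g x) =
    fun x => nat_rec (fun=> nat) (f x) (fun _ r => r.+1) (g x).
  by apply: funext => x; elim: (g x) => [|m /= <-]; rewrite ?addn0 ?addnS.
apply: (@computable_rec id (fun _ _ r => r.+1)) => //; first exact: computable_id.
by do ?apply: computable_succ; do ?apply: computable_snd; apply: computable_id.
Qed.

Lemma computable_mul f g :
  computable f -> computable g -> computable (fun x => f x * g x).
Proof.
move=> cf cg.
have -> : (fun x => f x * g x) =
    fun x => nat_rec (fun=> nat) 0 (fun _ r => r + f x) (g x).
  by apply: funext => x; elim: (g x) => [|m /= <-]; rewrite ?muln0 // mulnSr.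
apply: (@computable_rec (fun=> 0) (fun a _ r => r + a)) => //.
  exact: computable_const.
apply: computable_add; first by do 2!apply: computable_snd; apply: computable_id.
by apply: computable_fst; apply: computable_id.
Qed.

Lemma computable_pred f : computable f -> computable (fun x => (f x).-1).
Proof.
move=> cf.
have -> : (fun x => (f x).-1) = fun x => nat_rec (fun=> nat) 0 (fun m _ => m) (f x).
  by apply: funext => x; case: (f x).
apply: (@computable_rec (fun=> 0) (fun _ m _ => m) f) => //.
  exact: computable_const.
by apply: computable_fst; apply: computable_snd; apply: computable_id.
Qed.

Lemma computable_sub f g :
  computable f -> computable g -> computable (fun x => f x - g x).
Proof.
move=> cf cg.
have -> : (fun x => f x - g x) =
    fun x => nat_rec (fun=> nat) (f x) (fun _ r => r.-1) (g x).
  by apply: funext => x; elim: (g x) => [|m /= <-]; rewrite ?subn0 ?subnS.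
apply: (@computable_rec id (fun _ _ r => r.-1)) => //; first exact: computable_id.
by apply: computable_pred; do 2!apply: computable_snd; apply: computable_id.
Qed.

(** Every number codes an environment, an infinite stream that is eventually 0
    since [0] is the pair of [0] and [0]. *)
Definition decode (x : nat) : env := fun i => nfst (iter i nsnd x).

Lemma decode_cons a x : decode (npair a x) = ncons a (decode x).
Proof.
by apply: funext => -[|i]; rewrite /decode ?iterSr /= ?npairK1 ?npairK2.
Qed.

Lemma computable_teval t : computable (fun x => teval (decode x) t).
Proof.
elim: t => [i||t|t IHt u IHu|t IHt u IHu] /=.
- apply: computable_fst; elim: i => [|i IHi] /=; first exact: computable_id.
  exact: computable_snd.
- exact: computable_const.
- exact: computable_succ.
- exact: computable_add.
- exact: computable_mul.
Qed.

(** Zero stands for truth.  A bounded universal quantifier then becomes a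
    bounded sum, computed by primitive recursion. *)
Lemma Delta0_decidable p : Delta0 p ->
  exists2 f, computable f & forall x, sat (decode x) p <-> f x = 0.
Proof.
elim=> {p} [|t u|t u|p q _ [f cf fP] _ [g cg gP]|t p _ [f cf fP]].
- by exists (fun=> 1); first exact: computable_const.
- exists (fun x => (teval (decode x) t - teval (decode x) u) +
                   (teval (decode x) u - teval (decode x) t)) => [|x /=]; last lia.
  by apply: computable_add; apply: computable_sub; apply: computable_teval.
- exists (fun x => (teval (decode x) t).+1 - teval (decode x) u) => [|x /=]; last lia.
  by apply: computable_sub; try apply: computable_succ; apply: computable_teval.
- exists (fun x => (1 - f x) * g x) => [|x /=].
    apply: computable_mul => //; apply: computable_sub => //.
    exact: computable_const.
  rewrite fP gP; case: (f x) => [|n]; rewrite ?mul1n ?mul0n; split; auto.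
  by move=> _ /eqP.
exists (fun x => nat_rec (fun=> nat) 0 (fun m r => r + f (npair m x))
                         (teval (decode x) t)) => [|x].
  apply: (@computable_rec (fun=> 0) (fun a m r => r + f (npair m a)) id) => //.
  - exact: computable_const.
  - apply: computable_add; first by do 2!apply: computable_snd; apply: computable_id.
    apply: (computable_comp cf); apply: computable_pair.
      by apply: computable_fst; apply: computable_snd; apply: computable_id.
    by apply: computable_fst; apply: computable_id.
  - exact: computable_id.
  - exact: computable_teval.
rewrite sat_ball; elim: (teval _ t) => [|n IHn] /=; first by split.
split=> [h|/eqP].
  by rewrite (IHn.1 (fun a la => h a (ltnW la))); apply/fP; rewrite decode_cons; apply: h.
rewrite addn_eq0 => /andP[/eqP /IHn.2 h /eqP/fP]; rewrite decode_cons => hn a.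
by rewrite ltnS leq_eqVlt => /orP[/eqP -> //|/h].
Qed.

(** Unbounded search for the witness of the leading quantifier. *)
Theorem Sigma1_re (C : nat -> Prop) : Sigma1_set C -> re C.
Proof.
move=> [p /Delta0_decidable [f cf fP] pC].
have [c cP] : computable (fun z => f (npair (nsnd z) (npair (nfst z) 0))).
  apply: (computable_comp cf); apply: computable_pair.
    by apply: computable_snd; apply: computable_id.
  apply: computable_pair; last exact: computable_const.
  by apply: computable_fst; apply: computable_id.
have {}pC x : C x <-> exists b, f (npair b (npair x 0)) = 0.
  rewrite -{1}[x](npairK1 x 0) (pC (decode (npair x 0))).
  by split=> -[b h]; exists b; move: h; rewrite -decode_cons fP.
exists (c_min c) => x; rewrite pC; split=> [h|[y [/cP]]]; last first.
  by rewrite npairK1 npairK2 => h _; exists y.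
have {}h : exists b, f (npair b (npair x 0)) == 0 by case: h => b fb; exists b; apply/eqP.
case: (ex_minnP h) => y /eqP fy ymin; exists y; split.
  by apply/cP; rewrite npairK1 npairK2.
move=> z lzy; exists (f (npair z (npair x 0))).-1; apply/cP.
rewrite npairK1 npairK2; case E: (f _) => //.
have /ymin : f (npair z (npair x 0)) == 0 by rewrite E.
by rewrite leqNgt lzy.
Qed.

(** * Arithmetization of syntax *)

Ltac unpair :=
  repeat match goal with
  | H : npair _ _ = npair _ _ |- _ =>
      let H1 := fresh in let H2 := fresh in
      case: (npair_inj H) => H1 H2; clear H; try discriminate H1; try subst
  end.

Lemma tgodel_inj : injective tgodel.
Proof.
elim=> [i||t IHt|t IHt u IHu|t IHt u IHu] [j||t'|t' u'|t' u'] //= h; unpair => //;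
  by f_equal; auto.
Qed.

Lemma godel_inj : injective godel.
Proof.
elim=> [|t u|t u|p IHp q IHq|p IHp] [|t' u'|t' u'|p' q'|p'] //= h; unpair => //;
  by f_equal; auto using tgodel_inj.
Qed.

Definition is_term (x : nat) : Prop := exists t, x = tgodel t.
Definition is_form (x : nat) : Prop := exists p, x = godel p.

Lemma Sigma1_is_term : Sigma1_set is_term.
Proof.
apply: (@Sigma1_least _
  (fun x => (exists i, x = npair 0 i) \/ x = npair 1 0)
  (fun x y z => x = npair 2 y \/ x = npair 3 (npair y z) \/ x = npair 4 (npair y z))).
- by rewrite /Sigma1_set; sigma1.
- by sigma1.
- by move=> x [[i ->]|->]; [exists (Var i)|exists Zero].
- move=> x y z r [t yt] [u zu]; subst y z.
  by case: r => [->|[->|->]]; [exists (Succ t)|exists (Add t u)|exists (Mul t u)].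
move=> _ [t ->]; elim: t => [i||t IHt|t IHt u IHu|t IHt u IHu] /=.
- by apply: generated_base; left; exists i.
- by apply: generated_base; right.
- by apply: (generated_rule _ IHt IHt); left.
- by apply: (generated_rule _ IHt IHu); right; left.
- by apply: (generated_rule _ IHt IHu); right; right.
Qed.
#[local] Hint Resolve Sigma1_is_term : sigma1.

Lemma Sigma1_is_form : Sigma1_set is_form.
Proof.
apply: (@Sigma1_least _
  (fun x => x = npair 0 0 \/ exists a b, is_term a /\ is_term b /\
     (x = npair 1 (npair a b) \/ x = npair 2 (npair a b)))
  (fun x y z => x = npair 3 (npair y z) \/ x = npair 4 y)).
- by rewrite /Sigma1_set; sigma1.
- by sigma1.
- move=> x [->|[_ [_ [[t ->] [[u ->] [->|->]]]]]]; first by exists Bot.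
    by exists (Eq t u).
  by exists (Lt t u).
- move=> x y z r [p yp] [q zq]; subst y z.
  by case: r => [->|->]; [exists (Imp p q)|exists (All p)].
move=> _ [p ->]; elim: p => [|t u|t u|p IHp q IHq|p IHp] /=.
- by apply: generated_base; left.
- apply: generated_base; right; exists (tgodel t), (tgodel u).
  by split; [exists t|split; [exists u|left]].
- apply: generated_base; right; exists (tgodel t), (tgodel u).
  by split; [exists t|split; [exists u|right]].
- by apply: (generated_rule _ IHp IHq); left.
- by apply: (generated_rule _ IHp IHp); right.
Qed.
#[local] Hint Resolve Sigma1_is_form : sigma1.

Definition tshift_graph (x : nat) : Prop :=
  exists t, x = npair (tgodel t) (tgodel (tshift t)).

Lemma Sigma1_tshift : Sigma1_set tshift_graph.
Proof.
apply: (@Sigma1_least _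
  (fun x => (exists i, x = npair (npair 0 i) (npair 0 i.+1)) \/
            x = npair (npair 1 0) (npair 1 0))
  (fun x y z => exists a a' b b', y = npair a a' /\ z = npair b b' /\
     (x = npair (npair 2 a) (npair 2 a') \/
      x = npair (npair 3 (npair a b)) (npair 3 (npair a' b')) \/
      x = npair (npair 4 (npair a b)) (npair 4 (npair a' b'))))).
- by rewrite /Sigma1_set; sigma1.
- by sigma1.
- by move=> _ [[i ->]|->]; [exists (Var i)|exists Zero].
- move=> x _ _ [a [a' [b [b' [-> [-> r]]]]]] [t e1] [u e2]; unpair.
  by case: r => [->|[->|->]]; [exists (Succ t)|exists (Add t u)|exists (Mul t u)].
move=> _ [t ->]; elim: t => [i||t IHt|t IHt u IHu|t IHt u IHu].
- by apply: generated_base; left; exists i.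
- by apply: generated_base; right.
- apply: (generated_rule _ IHt IHt); do 4!eexists; do 2!(split; first by []).
  by left.
- apply: (generated_rule _ IHt IHu); do 4!eexists; do 2!(split; first by []).
  by right; left.
- apply: (generated_rule _ IHt IHu); do 4!eexists; do 2!(split; first by []).
  by right; right.
Qed.
#[local] Hint Resolve Sigma1_tshift : sigma1.

(** Substitutions are infinite objects.  Those of the proof calculus are built
    from a few basic ones by [scons] and by the lifting under a binder, so they
    have finite descriptions, which can be coded. *)
Inductive desc : Type :=
| d_id
| d_shift
| d_zero
| d_cons of term & desc
| d_lift of desc.

Fixpoint den (d : desc) : nat -> term :=
  match d with
  | d_id => Var
  | d_shift => fun i => Var i.+1
  | d_zero => fun=> Zero
  | d_cons t d => scons t (den d)
  | d_lift d => fun i => tshift (den d i)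
  end.

Definition d_up (d : desc) : desc := d_cons (Var 0) (d_lift d).

Fixpoint dgodel (d : desc) : nat :=
  match d with
  | d_id => npair 0 0
  | d_shift => npair 1 0
  | d_zero => npair 2 0
  | d_cons t d => npair 3 (npair (tgodel t) (dgodel d))
  | d_lift d => npair 4 (dgodel d)
  end.

Lemma dgodel_inj : injective dgodel.
Proof.
elim=> [||| t d IHd | d IHd] [||| t' d' | d'] //= h; unpair => //;
  by f_equal; auto using tgodel_inj.
Qed.

Definition is_desc (x : nat) : Prop := exists d, x = dgodel d.

Lemma Sigma1_is_desc : Sigma1_set is_desc.
Proof.
apply: (@Sigma1_least _
  (fun x => x = npair 0 0 \/ x = npair 1 0 \/ x = npair 2 0)
  (fun x y z => (exists t, is_term t /\ x = npair 3 (npair t y)) \/ x = npair 4 y)).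
- by rewrite /Sigma1_set; sigma1.
- by sigma1.
- by move=> x [->|[->|->]]; [exists d_id|exists d_shift|exists d_zero].
- move=> x y z r [d yd] _; subst y.
  by case: r => [[_ [[t ->] ->]]|->]; [exists (d_cons t d)|exists (d_lift d)].
move=> _ [d ->]; elim: d => [|||t d IHd|d IHd].
- by apply: generated_base; left.
- by apply: generated_base; right; left.
- by apply: generated_base; right; right.
- apply: (generated_rule _ IHd IHd); left; exists (tgodel t); split=> //; by exists t.
- by apply: (generated_rule _ IHd IHd); right.
Qed.
#[local] Hint Resolve Sigma1_is_desc : sigma1.

Definition den_graph (x : nat) : Prop :=
  exists d i, x = npair (dgodel d) (npair i (tgodel (den d i))).

(** Looking up a variable in a described substitution; lifting is where shifted
    terms enter. *)
Lemma Sigma1_den : Sigma1_set den_graph.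
Proof.
apply: (@Sigma1_least _
  (fun x => exists i,
     x = npair (npair 0 0) (npair i (npair 0 i)) \/
     x = npair (npair 1 0) (npair i (npair 0 i.+1)) \/
     x = npair (npair 2 0) (npair i (npair 1 0)) \/
     exists t d, is_term t /\ is_desc d /\
       x = npair (npair 3 (npair t d)) (npair 0 t))
  (fun x y z => exists d i u, y = npair d (npair i u) /\
     ((exists t, is_term t /\ x = npair (npair 3 (npair t d)) (npair i.+1 u)) \/
      (exists u', tshift_graph (npair u u') /\ x = npair (npair 4 d) (npair i u'))))).
- by rewrite /Sigma1_set; sigma1.
- by sigma1.
- move=> _ [i [->|[->|[->|[_ [_ [[t ->] [[d ->] ->]]]]]]]].
  + by exists d_id, i.
  + by exists d_shift, i.
  + by exists d_zero, i.
  + by exists (d_cons t d), 0.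
- move=> x _ z [d' [i' [u' [-> r]]]] [d [i h]] _; unpair.
  case: r => [[_ [[t ->] ->]]|[u [[t h] ->]]]; first by exists (d_cons t d), i.+1.
  case: (npair_inj h) => /tgodel_inj <- ->; by exists (d_lift d), i.
move=> _ [d [i ->]]; elim: d i => [|||t d IHd|d IHd] i.
- by apply: generated_base; exists i; left.
- by apply: generated_base; exists i; right; left.
- by apply: generated_base; exists i; right; right; left.
- case: i => [|i].
    apply: generated_base; exists 0; do 3!right; exists (tgodel t), (dgodel d).
    by split; [exists t|split; [exists d|]].
  apply: (generated_rule _ (IHd i) (IHd i)); do 3!eexists; split; first by [].
  by left; exists (tgodel t); split; first by exists t.
- apply: (generated_rule _ (IHd i) (IHd i)); do 3!eexists; split; first by [].
  by right; eexists; split; first by exists (den d i).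
Qed.
#[local] Hint Resolve Sigma1_den : sigma1.

Definition tsubst_graph (x : nat) : Prop :=
  exists d t, x = npair (dgodel d) (npair (tgodel t) (tgodel (tsubst (den d) t))).

Lemma Sigma1_tsubst : Sigma1_set tsubst_graph.
Proof.
apply: (@Sigma1_least _
  (fun x => exists d, is_desc d /\
     ((exists i u, den_graph (npair d (npair i u)) /\ x = npair d (npair (npair 0 i) u)) \/
      x = npair d (npair (npair 1 0) (npair 1 0))))
  (fun x y z => exists d a a' b b',
     y = npair d (npair a a') /\ z = npair d (npair b b') /\
     (x = npair d (npair (npair 2 a) (npair 2 a')) \/
      x = npair d (npair (npair 3 (npair a b)) (npair 3 (npair a' b'))) \/
      x = npair d (npair (npair 4 (npair a b)) (npair 4 (npair a' b')))))).
- by rewrite /Sigma1_set; sigma1.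
- by sigma1.
- move=> _ [_ [[d ->] [[i [u [[d' [i' h]] ->]]]|->]]]; last by exists d, Zero.
  by case: (npair_inj h) => /dgodel_inj <- {}h; unpair; exists d, (Var i').
- move=> x _ _ [d' [a [a' [b [b' [-> [-> r]]]]]]] [d [t e1]] [d2 [u e2]].
  case: (npair_inj e1) => ? {}e1; case: (npair_inj e2) => ? {}e2; unpair.
  have ? : d2 = d by apply: dgodel_inj. subst.
  by case: r => [->|[->|->]]; exists d;
    [exists (Succ t)|exists (Add t u)|exists (Mul t u)].
move=> _ [d [t ->]].
have isd : is_desc (dgodel d) by exists d.
elim: t => [i||t IHt|t IHt u IHu|t IHt u IHu].
- apply: generated_base; exists (dgodel d); split=> //; left.
  by exists i, (tgodel (den d i)); split=> //; exists d, i.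
- by apply: generated_base; exists (dgodel d); split=> //; right.
- apply: (generated_rule _ IHt IHt); do 5!eexists; do 2!(split; first by []).
  by left.
- apply: (generated_rule _ IHt IHu); do 5!eexists; do 2!(split; first by []).
  by right; left.
- apply: (generated_rule _ IHt IHu); do 5!eexists; do 2!(split; first by []).
  by right; right.
Qed.
#[local] Hint Resolve Sigma1_tsubst : sigma1.

Definition fsubst_graph (x : nat) : Prop :=
  exists d p, x = npair (dgodel d) (npair (godel p) (godel (fsubst (den d) p))).

Lemma Sigma1_fsubst : Sigma1_set fsubst_graph.
Proof.
(* The code of [d_up d], used when substitution passes under a quantifier. *)
pose upc d := npair 3 (npair (npair 0 0) (npair 4 d)).
apply: (@Sigma1_least _
  (fun x => exists d, is_desc d /\
     (x = npair d (npair (npair 0 0) (npair 0 0)) \/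
      exists a a' b b', tsubst_graph (npair d (npair a a')) /\
        tsubst_graph (npair d (npair b b')) /\
        (x = npair d (npair (npair 1 (npair a b)) (npair 1 (npair a' b'))) \/
         x = npair d (npair (npair 2 (npair a b)) (npair 2 (npair a' b'))))))
  (fun x y z => exists d a a' b b', is_desc d /\
     ((y = npair d (npair a a') /\ z = npair d (npair b b') /\
       x = npair d (npair (npair 3 (npair a b)) (npair 3 (npair a' b')))) \/
      (y = npair (upc d) (npair a a') /\
       x = npair d (npair (npair 4 a) (npair 4 a')))))).
- by rewrite /Sigma1_set; sigma1.
- by rewrite /upc; sigma1.
- move=> x [_ [[d ->] [->|[a [a' [b [b' [[d1 [t h1]] [[d2 [u h2]] r]]]]]]]]].
    by exists d, Bot.
  case: (npair_inj h1) => /dgodel_inj ? {}h1; case: (npair_inj h2) => /dgodel_inj ? {}h2.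
  by unpair; move: r => [->|->]; exists d2; [exists (Eq t u)|exists (Lt t u)].
- move=> x y z [_ [a [a' [b [b' [[d ->] r]]]]]] [d1 [p yp]] [d2 [q zq]]; subst y z.
  case: r => [[h1 [h2 ->]]|[h1 ->]].
    case: (npair_inj h1) => /dgodel_inj ? {}h1; case: (npair_inj h2) => /dgodel_inj ? {}h2.
    by unpair; exists d, (Imp p q).
  case: (npair_inj h1) => /(@dgodel_inj d1 (d_up d)) ? {}h1.
  by unpair; exists d, (All p).
move=> _ [d [p ->]].
elim: p d => [|t u|t u|p IHp q IHq|p IHp] d; have isd : is_desc (dgodel d) by exists d.
- by apply: generated_base; exists (dgodel d); split=> //; left.
- apply: generated_base; exists (dgodel d); split=> //; right; do 4!eexists.
  split; first by exists d, t.
  by split; first by [exists d, u]; left.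
- apply: generated_base; exists (dgodel d); split=> //; right; do 4!eexists.
  split; first by exists d, t.
  by split; first by [exists d, u]; right.
- apply: (generated_rule _ (IHp d) (IHq d)); do 5!eexists; split; first exact: isd.
  by left.
- apply: (generated_rule _ (IHp (d_up d)) (IHp (d_up d))); exists (dgodel d).
  do 2!eexists; exists 0, 0; split=> //; right; split; reflexivity.
Qed.
#[local] Hint Resolve Sigma1_fsubst : sigma1.

Definition tbound_graph (x : nat) : Prop :=
  exists k t, tbound k t /\ x = npair k (tgodel t).

Lemma Sigma1_tbound : Sigma1_set tbound_graph.
Proof.
apply: (@Sigma1_least _
  (fun x => exists k, x = npair k (npair 1 0) \/
     exists i, i < k /\ x = npair k (npair 0 i))
  (fun x y z => exists k a b, y = npair k a /\ z = npair k b /\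
     (x = npair k (npair 2 a) \/ x = npair k (npair 3 (npair a b)) \/
      x = npair k (npair 4 (npair a b))))).
- by rewrite /Sigma1_set; sigma1.
- by sigma1.
- by move=> _ [k [->|[i [li ->]]]]; exists k; [exists Zero|exists (Var i)].
- move=> x _ _ [k [a [b [-> [-> r]]]]] [k1 [t [bt e1]]] [k2 [u [bu e2]]]; unpair.
  exists k1; case: r => [->|[->|->]];
    [exists (Succ t)|exists (Add t u)|exists (Mul t u)]; by rewrite /= ?bt ?bu.
move=> _ [k [t [+ ->]]]; elim: t => [i||t IHt|t IHt u IHu|t IHt u IHu] /=.
- by move=> li; apply: generated_base; exists k; right; exists i.
- by move=> _; apply: generated_base; exists k; left.
- move=> /IHt ct; apply: (generated_rule _ ct ct); do 3!eexists.
  by do 2!(split; first by []); left.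
- move=> /andP[/IHt ct /IHu cu]; apply: (generated_rule _ ct cu); do 3!eexists.
  by do 2!(split; first by []); right; left.
- move=> /andP[/IHt ct /IHu cu]; apply: (generated_rule _ ct cu); do 3!eexists.
  by do 2!(split; first by []); right; right.
Qed.
#[local] Hint Resolve Sigma1_tbound : sigma1.

Definition fbound_graph (x : nat) : Prop :=
  exists k p, fbound k p /\ x = npair k (godel p).

Lemma Sigma1_fbound : Sigma1_set fbound_graph.
Proof.
apply: (@Sigma1_least _
  (fun x => exists k, x = npair k (npair 0 0) \/
     exists a b, tbound_graph (npair k a) /\ tbound_graph (npair k b) /\
       (x = npair k (npair 1 (npair a b)) \/ x = npair k (npair 2 (npair a b))))
  (fun x y z => exists k a b,
     (y = npair k a /\ z = npair k b /\ x = npair k (npair 3 (npair a b))) \/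
     (y = npair k.+1 a /\ x = npair k (npair 4 a)))).
- by rewrite /Sigma1_set; sigma1.
- by sigma1.
- move=> x [k [->|[a [b [[k1 [t [bt e1]]] [[k2 [u [bu e2]]] r]]]]]].
    by exists k, Bot.
  by unpair; case: r => ->; exists k1; [exists (Eq t u)|exists (Lt t u)];
    rewrite /= bt bu.
- move=> x y z [k [a [b r]]] [k1 [p [bp yp]]] [k2 [q [bq zq]]]; subst y z.
  case: r => [[h1 [h2 ->]]|[h1 ->]]; unpair.
    by exists k, (Imp p q); rewrite /= bp bq.
  by exists k, (All p).
move=> _ [k [p [+ ->]]]; elim: p k => [|t u|t u|p IHp q IHq|p IHp] k /=.
- by move=> _; apply: generated_base; exists k; left.
- move=> /andP[bt bu]; apply: generated_base; exists k; right; do 2!eexists.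
  by split; [exists k, t|split; [exists k, u|left]].
- move=> /andP[bt bu]; apply: generated_base; exists k; right; do 2!eexists.
  by split; [exists k, t|split; [exists k, u|right]].
- move=> /andP[/IHp cp /IHq cq]; apply: (generated_rule _ cp cq); do 3!eexists.
  by left.
- by move=> /IHp cp; apply: (generated_rule _ cp cp); exists k, (godel p), 0; right.
Qed.
#[local] Hint Resolve Sigma1_fbound : sigma1.

Definition num (m : nat) : term := iter m Succ Zero.

Definition num_graph (x : nat) : Prop := exists m, x = npair m (tgodel (num m)).

Lemma Sigma1_num : Sigma1_set num_graph.
Proof.
apply: (@Sigma1_least _
  (fun x => x = npair 0 (npair 1 0))
  (fun x y z => exists m a, y = npair m a /\ x = npair m.+1 (npair 2 a))).
- by rewrite /Sigma1_set; sigma1.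
- by sigma1.
- by move=> _ ->; exists 0.
- by move=> _ _ z [m [a [-> ->]]] [m' h] _; unpair; exists m'.+1.
move=> _ [m ->]; elim: m => [|m IHm]; first exact: generated_base.
by apply: (generated_rule _ IHm IHm); do 2!eexists.
Qed.
#[local] Hint Resolve Sigma1_num : sigma1.

(** The universal closures of a formula by blocks of quantifiers, for the
    parameters of the induction axioms. *)
Definition closure_graph (x : nat) : Prop :=
  exists k p, x = npair (godel p) (godel (iter k All p)).

Lemma Sigma1_closure : Sigma1_set closure_graph.
Proof.
apply: (@Sigma1_least _
  (fun x => exists a, is_form a /\ x = npair a a)
  (fun x y z => exists a b, y = npair a b /\ x = npair a (npair 4 b))).
- by rewrite /Sigma1_set; sigma1.
- by sigma1.
- by move=> _ [_ [[p ->] ->]]; exists 0, p.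
- by move=> _ _ z [a [b [-> ->]]] [k [p h]] _; unpair; exists k.+1, p.
move=> _ [k [p ->]]; elim: k => [|k IHk].
  by apply: generated_base; eexists; split; first by exists p.
by apply: (generated_rule _ IHk IHk); do 2!eexists.
Qed.
#[local] Hint Resolve Sigma1_closure : sigma1.

Definition is_induction (x : nat) : Prop :=
  exists p a b : nat,
  [/\ is_form p,
      fsubst_graph (npair (dgodel (d_cons Zero d_id)) (npair p a)),
      fsubst_graph (npair (dgodel (d_cons (Succ (Var 0)) d_shift)) (npair p b)) &
      x = npair 3 (npair a (npair 3 (npair
            (npair 4 (npair 3 (npair p b))) (npair 4 p))))].

Lemma fsubst_graphE d p x :
  fsubst_graph (npair (dgodel d) (npair (godel p) x)) <->
  x = godel (fsubst (den d) p).
Proof.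
split=> [[d' [p' h]]|->]; last by exists d, p.
case: (npair_inj h) => /dgodel_inj <- {}h.
by case: (npair_inj h) => /godel_inj <-.
Qed.

Lemma is_inductionE x : is_induction x <-> exists p, x = godel (induction p).
Proof.
have E p : fsubst (fun i => if i is j.+1 then Var j.+1 else Succ (Var 0)) p =
    fsubst (den (d_cons (Succ (Var 0)) d_shift)) p.
  by congr fsubst; apply: funext => -[].
split=> [[_ [a [b [[p ->]]]]]|[p ->]].
  by rewrite !fsubst_graphE => -> -> ->; exists p; rewrite /induction E.
do 3!eexists; split; first by exists p.
- exact/fsubst_graphE.
- exact/fsubst_graphE.
by rewrite /induction E.
Qed.

Lemma Sigma1_is_induction : Sigma1_set is_induction.
Proof.
rewrite /Sigma1_set; apply: (@Sigma1_ext (fun e => exists p a b : nat,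
  is_form p /\
  fsubst_graph (npair (dgodel (d_cons Zero d_id)) (npair p a)) /\
  fsubst_graph (npair (dgodel (d_cons (Succ (Var 0)) d_shift)) (npair p b)) /\
  e 0 = npair 3 (npair a (npair 3 (npair
            (npair 4 (npair 3 (npair p b))) (npair 4 p)))))).
  by move=> e; split=> [[p [a [b [? [? []]]]]]|[p [a [b []]]]]; exists p, a, b.
by sigma1.
Qed.
#[local] Hint Resolve Sigma1_is_induction : sigma1.

Definition PA_basic : seq form :=
  [:: All (Neg (Eq (Succ (Var 0)) Zero));
      All (All (Imp (Eq (Succ (Var 1)) (Succ (Var 0))) (Eq (Var 1) (Var 0))));
      All (Eq (Add (Var 0) Zero) (Var 0));
      All (All (Eq (Add (Var 1) (Succ (Var 0))) (Succ (Add (Var 1) (Var 0)))));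
      All (Eq (Mul (Var 0) Zero) Zero);
      All (All (Eq (Mul (Var 1) (Succ (Var 0)))
                   (Add (Mul (Var 1) (Var 0)) (Var 1))));
      All (Neg (Lt (Var 0) Zero));
      All (All (Iff (Lt (Var 1) (Succ (Var 0)))
                    (Or (Lt (Var 1) (Var 0)) (Eq (Var 1) (Var 0)))))].

Definition is_PA (x : nat) : Prop := exists2 p, PA p & x = godel p.

Definition is_listed (s : seq form) (x : nat) : Prop :=
  exists2 p, List.In p s & x = godel p.

Lemma Sigma1_listed s : Sigma1_set (is_listed s).
Proof.
rewrite /Sigma1_set; elim: s => [|q s IHs].
  by apply: Sigma1_ext (Sigma1_sat Delta0_Bot) => e; split=> // -[].
apply: (@Sigma1_ext (fun e => e 0 = godel q \/ is_listed s (e 0))).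
  move=> e; split=> [[->|[p ps ->]]|[p [->|ps] ->]].
  - by exists q => //; left.
  - by exists p => //; right.
  - by left.
  - by right; exists p.
by apply: Sigma1_or => //; sigma1.
Qed.
#[local] Hint Resolve Sigma1_listed : sigma1.

Lemma Sigma1_PA : Sigma1_set is_PA.
Proof.
rewrite /Sigma1_set.
apply: (@Sigma1_ext (fun e => is_listed PA_basic (e 0) \/
   exists q, is_induction q /\ closure_graph (npair q (e 0)) /\
     fbound_graph (npair 0 (e 0)))).
  move=> e; split=> [[[p ps ->]|[_ [/is_inductionE[p ->] [[k [q h]] [k' [r [br h']]]]]]]|].
  - exists p => //; move: ps => /=.
    by do 8!(case=> [<-|]; first by constructor).
  - case: (npair_inj h) => /godel_inj <- {}h; case: (npair_inj h') => E0 h2.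
    exists (iter k All (induction p)) => //; constructor.
    by rewrite /sentence /= (_ : iter _ _ _ = r) ?E0 //; apply: godel_inj; rewrite -h.
  - case=> p; case=> {p} [||||||||k p s] ->;
      try by left; eexists; last reflexivity; rewrite /=; tauto.
    right; exists (godel (induction p)); split; first by apply/is_inductionE; exists p.
    by split; [exists k, (induction p)|exists 0, (iter k All (induction p))].
by sigma1.
Qed.
#[local] Hint Resolve Sigma1_PA : sigma1.

(** * Arithmetization of provability *)

Inductive logical : form -> Prop :=
| logical_K p q : logical (Imp p (Imp q p))
| logical_S p q r :
    logical (Imp (Imp p (Imp q r)) (Imp (Imp p q) (Imp p r)))
| logical_DN p : logical (Imp (Neg (Neg p)) p)
| logical_dist p q : logical (Imp (All (Imp p q)) (Imp (All p) (All q)))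
| logical_inst p t : logical (Imp (All p) (inst p t))
| logical_vac p : logical (Imp p (All (fshift p)))
| logical_refl t : logical (Eq t t)
| logical_leibniz p t u : logical (Imp (Eq t u) (Imp (inst p t) (inst p u))).

Lemma logical_prv T p : logical p -> prv T p.
Proof. by case=> *; constructor. Qed.

Definition is_logical (x : nat) : Prop := exists2 p, logical p & x = godel p.

Notation nBot := (npair 0 0).
Notation nEq t u := (npair 1 (npair t u)).
Notation nImp p q := (npair 3 (npair p q)).
Notation nAll p := (npair 4 p).
Notation ninst t := (npair 3 (npair t (npair 0 0))).
Notation nshift := (npair 1 0).

Lemma ninstE p t x :
  fsubst_graph (npair (ninst (tgodel t)) (npair (godel p) x)) <-> x = godel (inst p t).
Proof. exact: (fsubst_graphE (d_cons t d_id)). Qed.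

Lemma nshiftE p x :
  fsubst_graph (npair nshift (npair (godel p) x)) <-> x = godel (fshift p).
Proof. exact: (fsubst_graphE d_shift). Qed.

Lemma Sigma1_logical : Sigma1_set is_logical.
Proof.
rewrite /Sigma1_set.
apply: (@Sigma1_ext (fun e =>
  (exists p q r, is_form p /\ is_form q /\ is_form r /\
     (e 0 = nImp p (nImp q p) \/
      e 0 = nImp (nImp p (nImp q r)) (nImp (nImp p q) (nImp p r)) \/
      e 0 = nImp (nImp (nImp p nBot) nBot) p \/
      e 0 = nImp (nAll (nImp p q)) (nImp (nAll p) (nAll q)))) \/
  (exists t u, is_term t /\ is_term u /\
     (e 0 = nEq t t \/
     exists p a b, is_form p /\ fsubst_graph (npair (ninst t) (npair p a)) /\
       fsubst_graph (npair (ninst u) (npair p b)) /\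
       (e 0 = nImp (nAll p) a \/ e 0 = nImp (nEq t u) (nImp a b)))) \/
  (exists p a, is_form p /\ fsubst_graph (npair nshift (npair p a)) /\
     e 0 = nImp p (nAll a)))); last by sigma1.
move=> e; split=> [|[p lp ->]].
  case=> [[_ [_ [_ [[p ->] [[q ->] [[r ->] h]]]]]]|[]].
  - case: h => [->|[->|[->|->]]].
    + by eexists; first exact: (logical_K p q).
    + by eexists; first exact: (logical_S p q r).
    + by eexists; first exact: (logical_DN p).
    + by eexists; first exact: (logical_dist p q).
  - move=> [_ [_ [[t ->] [[u ->] [->|]]]]]; first by exists (Eq t t); first by constructor.
    move=> [_ [a [b [[p ->] [/ninstE -> [/ninstE -> [->|->]]]]]]].
      by eexists; first exact: (logical_inst p t).
    by eexists; first exact: (logical_leibniz p t u).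
  - move=> [_ [a [[p ->] [/nshiftE -> ->]]]].
    by exists (Imp p (All (fshift p))); first by constructor.
have isf r : is_form (godel r) by exists r.
have ist t : is_term (tgodel t) by exists t.
case: lp => {p} [p q|p q r|p|p q|p t|p|t|p t u].
- by left; exists (godel p), (godel q), (godel q); do !split=> //; left.
- by left; exists (godel p), (godel q), (godel r); do !split=> //; right; left.
- by left; exists (godel p), (godel p), (godel p); do !split=> //; do 2!right; left.
- by left; exists (godel p), (godel q), (godel q); do !split=> //; do 3!right.
- right; left; exists (tgodel t), (tgodel t); do 2!split=> //; right.
  exists (godel p), (godel (inst p t)), (godel (inst p t)).
  by rewrite !ninstE; do !split=> //; left.
- right; right; exists (godel p), (godel (fshift p)).
  by rewrite nshiftE.
- by right; left; exists (tgodel t), (tgodel t); do 2!split=> //; left.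
- right; left; exists (tgodel t), (tgodel u); do 2!split=> //; right.
  exists (godel p), (godel (inst p t)), (godel (inst p u)).
  by rewrite !ninstE; do !split=> //; right.
Qed.
#[local] Hint Resolve Sigma1_logical : sigma1.

(** Provability is coded uniformly in two additional axioms because the diagonal
    argument quantifies over the pair of sentences. *)
Definition PA2 (c d : form) : set form := PA `|` [set c; d].

Definition prv_graph (x : nat) : Prop :=
  exists c d r, prv (PA2 c d) r /\ x = npair (npair (godel c) (godel d)) (godel r).

Lemma Sigma1_prv : Sigma1_set prv_graph.
Proof.
apply: (@Sigma1_least _
  (fun x => exists c d r, is_form c /\ is_form d /\ x = npair (npair c d) r /\
     (is_PA r \/ r = c \/ r = d \/ is_logical r))
  (fun x y z => exists e p q, is_form q /\
     ((y = npair e (nImp p q) /\ z = npair e p /\ x = npair e q) \/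
      (y = npair e p /\ x = npair e (nAll p))))).
- by rewrite /Sigma1_set; sigma1.
- by sigma1.
- move=> x [_ [_ [r [[c ->] [[d ->] [-> h]]]]]]; exists c, d.
  case: h => [[p ? ->]|[->|[->|[p /logical_prv h ->]]]].
  + by exists p; split=> //; apply: prv_ax; left.
  + by exists c; split=> //; apply: prv_ax; right; left.
  + by exists d; split=> //; apply: prv_ax; right; right.
  + by exists p.
- move=> x y z [e [a [_ [[q ->] h]]]] [c [d [r [pr yr]]]] [c' [d' [s [ps zs]]]].
  subst y z; case: h => [[h1 [h2 ->]]|[h1 ->]].
    case: (npair_inj h1) => E h3; case: (npair_inj h2) => E' h4; subst.
    case: (npair_inj E') => /godel_inj ? /godel_inj ?; subst.
    (* [q] is a formula, so the premise coded by an implication is one. *)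
    have ? : r = Imp s q by apply: godel_inj. subst.
    by exists c, d, q; split=> //; apply: prv_mp pr ps.
  by unpair; exists c, d, (All r); split=> //; apply: prv_gen.
move=> _ [c [d [r [pr ->]]]].
have isf s : is_form (godel s) by exists s.
have L s : logical s -> is_logical (godel s) by exists s.
elim: pr => {r}; try by
  move=> *; apply: generated_base; do 3!eexists;
  do 3!(split; [eauto|]); do 3!right; apply: L; constructor.
- move=> p h; apply: generated_base; do 3!eexists; do 3!(split; first by [eauto]).
  case: h => [?|[->|->]]; [left; by exists p|by right; left|by right; right; left].
- move=> p q _ cpq _ cp; apply: (generated_rule _ cpq cp); do 3!eexists.
  by split; first exact: isf; left.
- move=> p _ cp; apply: (generated_rule _ cp cp); do 2!eexists; exists (godel p).
  by split=> //; right.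
Qed.
#[local] Hint Resolve Sigma1_prv : sigma1.

(** * The halting set *)

Fixpoint cgodel (c : code) : nat :=
  match c with
  | c_zero => npair 0 0
  | c_succ => npair 1 0
  | c_fst => npair 2 0
  | c_snd => npair 3 0
  | c_pair f g => npair 4 (npair (cgodel f) (cgodel g))
  | c_comp f g => npair 5 (npair (cgodel f) (cgodel g))
  | c_prec f g => npair 6 (npair (cgodel f) (cgodel g))
  | c_min f => npair 7 (cgodel f)
  end.

Lemma cgodel_inj : injective cgodel.
Proof.
by elim=> [||||f IHf g IHg|f IHf g IHg|f IHf g IHg|f IHf]
  [||||f' g'|f' g'|f' g'|f'] //= h; unpair => //; f_equal; auto.
Qed.

Definition is_code (x : nat) : Prop := exists c, x = cgodel c.

Lemma Sigma1_is_code : Sigma1_set is_code.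
Proof.
apply: (@Sigma1_least _
  (fun x => x = npair 0 0 \/ x = npair 1 0 \/ x = npair 2 0 \/ x = npair 3 0)
  (fun x y z => x = npair 4 (npair y z) \/ x = npair 5 (npair y z) \/
     x = npair 6 (npair y z) \/ x = npair 7 y)).
- by rewrite /Sigma1_set; sigma1.
- by sigma1.
- by move=> x [->|[->|[->|->]]];
    [exists c_zero|exists c_succ|exists c_fst|exists c_snd].
- move=> x y z h [f yf] [g zg]; subst y z; case: h => [->|[->|[->|->]]];
    [by exists (c_pair f g)|by exists (c_comp f g)|by exists (c_prec f g)|by exists (c_min f)].
move=> _ [c ->]; elim: c => [||||f IHf g IHg|f IHf g IHg|f IHf g IHg|f IHf].
- by apply: generated_base; left.
- by apply: generated_base; right; left.
- by apply: generated_base; do 2!right; left.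
- by apply: generated_base; do 3!right.
- by apply: (generated_rule _ IHf IHg); left.
- by apply: (generated_rule _ IHf IHg); right; left.
- by apply: (generated_rule _ IHf IHg); do 2!right; left.
- by apply: (generated_rule _ IHf IHf); do 3!right.
Qed.
#[local] Hint Resolve Sigma1_is_code : sigma1.

(** Minimization has an unbounded number of premises.  This auxiliary judgement
    collects them one at a time, so that two premises per rule suffice. *)
Definition positive_below (c : code) (i n : nat) : Prop :=
  forall z, z < n -> exists w, eval c (npair i z) w.+1.

Definition eval_graph (x : nat) : Prop :=
  exists c i n, (eval c i n /\ x = npair 0 (npair (cgodel c) (npair i n))) \/
    (positive_below c i n /\ x = npair 1 (npair (cgodel c) (npair i n))).

Notation nev c i n := (npair 0 (npair c (npair i n))).
Notation npos c i n := (npair 1 (npair c (npair i n))).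

Lemma eval_graphE c i n : eval_graph (nev (cgodel c) i n) <-> eval c i n.
Proof.
split=> [[c' [i' [n' [[h1 h2]|[h1 h2]]]]]|h]; last by exists c, i, n; left.
  case: (npair_inj h2) => _ {}h2; case: (npair_inj h2) => /cgodel_inj -> {}h2.
  by case: (npair_inj h2) => -> ->.
by unpair.
Qed.

Lemma positive_graphE c i n : eval_graph (npos (cgodel c) i n) <-> positive_below c i n.
Proof.
split=> [[c' [i' [n' [[h1 h2]|[h1 h2]]]]]|h]; last by exists c, i, n; right.
  by unpair.
case: (npair_inj h2) => _ {}h2; case: (npair_inj h2) => /cgodel_inj -> {}h2.
by case: (npair_inj h2) => -> ->.
Qed.

Lemma Sigma1_eval : Sigma1_set eval_graph.
Proof.
apply: (@Sigma1_least _
  (fun x => exists i,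
     (x = nev (npair 0 0) i 0 \/ x = nev (npair 1 0) i i.+1) \/
     (exists a b, i = npair a b /\ (x = nev (npair 2 0) i a \/ x = nev (npair 3 0) i b)) \/
     exists c, is_code c /\ x = npos c i 0)
  (fun x y z => exists f g i a b, is_code f /\ is_code g /\
     ((y = nev f i a /\ z = nev g i b /\ x = nev (npair 4 (npair f g)) i (npair a b)) \/
      (y = nev f a b /\ z = nev g i a /\ x = nev (npair 5 (npair f g)) i b) \/
      (y = nev f i a /\ x = nev (npair 6 (npair f g)) (npair i 0) a) \/
      (exists m, y = nev (npair 6 (npair f g)) (npair i m) a /\
         z = nev g (npair i (npair m a)) b /\
         x = nev (npair 6 (npair f g)) (npair i m.+1) b) \/
      (y = nev f (npair i a) 0 /\ z = npos f i a /\ x = nev (npair 7 f) i a) \/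
      (y = npos f i a /\ z = nev f (npair i a) b.+1 /\ x = npos f i a.+1)))).
- by rewrite /Sigma1_set; sigma1.
- by sigma1.
- move=> x [i [[->|->]|[[a [b [-> [->|->]]]]|[_ [[c ->] ->]]]]].
  + by apply/(eval_graphE c_zero).
  + by apply/(eval_graphE c_succ).
  + by apply/(eval_graphE c_fst); rewrite /= npairK1.
  + by apply/(eval_graphE c_snd); rewrite /= npairK2.
  + by apply/positive_graphE.
- move=> x y z [_ [_ [i [a [b [[f ->] [[g ->] h]]]]]]].
  case: h => [[-> [-> ->]]|[[-> [-> ->]]|[[-> ->]|[[m [-> [-> ->]]]|[[-> [-> ->]]|[-> [-> ->]]]]]]].
  + move=> /eval_graphE hf /eval_graphE hg; apply/(eval_graphE (c_pair f g)).
    by exists a, b.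
  + move=> /eval_graphE hf /eval_graphE hg; apply/(eval_graphE (c_comp f g)).
    by exists a.
  + move=> /eval_graphE hf _; apply/(eval_graphE (c_prec f g)).
    by rewrite /= npairK1 npairK2.
  + move=> /(eval_graphE (c_prec f g)) /= + /eval_graphE hg.
    rewrite npairK1 npairK2 => hm; apply/(eval_graphE (c_prec f g)).
    by rewrite /= npairK1 npairK2; exists a.
  + by move=> /eval_graphE hf /positive_graphE hp; apply/(eval_graphE (c_min f)).
  + move=> /positive_graphE hp /eval_graphE hf; apply/positive_graphE => k.
    by rewrite ltnS leq_eqVlt => /orP[/eqP ->|/hp //]; exists b.
have isc c : is_code (cgodel c) by exists c.
set C := generated _ _.
have pos f : (forall i n, eval f i n -> C (nev (cgodel f) i n)) ->
    forall i n, positive_below f i n -> C (npos (cgodel f) i n).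
  move=> Hf i; elim=> [|n IHn] h.
    by apply: generated_base; exists i; do 2!right; exists (cgodel f).
  have [w /Hf cw] := h n (ltnSn n).
  have {}IHn := IHn (fun z lz => h z (ltnW lz)).
  apply: (generated_rule _ IHn cw); exists (cgodel f), (cgodel f), i, n, w.
  by do 2!split=> //; do 5!right.
suff ev c i n : eval c i n -> C (nev (cgodel c) i n).
  by move=> _ [c [i [n [[h ->]|[h ->]]]]]; [exact: ev|apply: pos => // ? ?; exact: ev].
elim: c i n => [||||f IHf g IHg|f IHf g IHg|f IHf g IHg|f IHf] i n /=.
- by move=> ->; apply: generated_base; exists i; left; left.
- by move=> ->; apply: generated_base; exists i; left; right.
- move=> ->; apply: generated_base; exists i; right; left; exists (nfst i), (nsnd i).
  by rewrite nfst_snd; split=> //; left.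
- move=> ->; apply: generated_base; exists i; right; left; exists (nfst i), (nsnd i).
  by rewrite nfst_snd; split=> //; right.
- move=> [a [b [/IHf ca /IHg cb ->]]]; apply: (generated_rule _ ca cb).
  by exists (cgodel f), (cgodel g), i, a, b; do 2!split=> //; left.
- move=> [a /IHg ca /IHf cb]; apply: (generated_rule _ cb ca).
  by exists (cgodel f), (cgodel g), i, a, n; do 2!split=> //; right; left.
- rewrite -[X in C (nev _ X _)](nfst_snd i); elim: (nsnd i) n => [|m IHm] n /=.
    move=> /IHf cf; apply: (generated_rule _ cf cf).
    by exists (cgodel f), (cgodel g), (nfst i), n, 0; do 2!split=> //; do 2!right; left.
  move=> [a /IHm ca /IHg cb]; apply: (generated_rule _ ca cb).
  exists (cgodel f), (cgodel g), (nfst i), a, n; do 2!split=> //; do 3!right; left.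
  by exists m.
- move=> [/IHf ca /(pos f IHf) cb]; apply: (generated_rule _ ca cb).
  by exists (cgodel f), (cgodel f), i, n, 0; do 2!split=> //; do 4!right; left.
Qed.
#[local] Hint Resolve Sigma1_eval : sigma1.

Definition halting (x : nat) : Prop := exists2 c, x = cgodel c & exists y, eval c x y.

Lemma Sigma1_halting : Sigma1_set halting.
Proof.
rewrite /Sigma1_set.
apply: (@Sigma1_ext (fun e => exists y, is_code (e 0) /\ eval_graph (nev (e 0) (e 0) y))).
  move=> e; split=> [[y [[c ->]]]|[c E [y h]]].
    by move=> /eval_graphE h; exists c => //; exists y.
  by exists y; rewrite E eval_graphE -E; split=> //; exists c.
by sigma1.
Qed.
#[local] Hint Resolve Sigma1_halting : sigma1.

(** A code [c] for the complement would halt on its own code exactly if it does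
    not. *)
Lemma halting_not_co_re : ~ re (~` halting).
Proof.
move=> [c cP]; have := cP (cgodel c).
have -> : (exists y, eval c (cgodel c) y) = halting (cgodel c).
  by apply/propext; split=> [h|[d /cgodel_inj <-]] //; exists c.
by move=> [h1 h2]; have nh : ~ halting (cgodel c) := fun h => h2 h h; exact: nh (h1 nh).
Qed.

(** * Two incomparable Sigma_1 sentences *)

(** The reduction property.  A point goes to the set whose least witness comes
    first, ties going to [Q]; the comparison only quantifies over numbers below
    the witness. *)
Lemma Sigma1_reduction P Q : Sigma1 P -> Sigma1 Q ->
  exists P' Q', [/\ Sigma1 P', Sigma1 Q',
    forall e, (P' e -> P e) /\ (Q' e -> Q e), forall e, ~ (P' e /\ Q' e)
    & forall e, P e \/ Q e -> P' e \/ Q' e].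
Proof.
move=> [p dp pP] [q dq qQ].
have S1 r : Delta0 r -> Sigma1 (fun e => sat (ncons (e 0) (fun i => e i.+2)) r).
  move=> /Sigma1_sat/(Sigma1_ren skip1); apply: Sigma1_ext => e.
  by rewrite (_ : (fun i => _) = ncons (e 0) (fun i => e i.+2)) //; apply: funext => -[].
have S0 r : Delta0 r -> Sigma1 (fun e => sat (ncons (e 0) (fun i => e i.+1)) r).
  move=> /Sigma1_sat; apply: Sigma1_ext => e.
  by rewrite (_ : ncons (e 0) (fun i => e i.+1) = e) //; apply: funext => -[].
exists (fun e => exists b, sat (ncons b e) p /\ forall c, c < b.+1 -> sat (ncons c e) (Neg q)).
exists (fun e => exists b, sat (ncons b e) q /\ forall c, c < b -> sat (ncons c e) (Neg p)).
split.
- apply: Sigma1_ex; apply: Sigma1_and; first exact: S0.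
  by apply: Sigma1_ball; [fn|apply/S1/Delta0_Neg].
- apply: Sigma1_ex; apply: Sigma1_and; first exact: S0.
  by apply: Sigma1_ball; [fn|apply/S1/Delta0_Neg].
- by move=> e; rewrite pP qQ; split=> -[b [h _]]; exists b.
- move=> e [[b [pb hb]] [c [qc hc]]]; have [lbc|lcb] := ltnP b c.
    exact: hc b lbc pb.
  exact: hb c lcb qc.
move=> e; rewrite pP qQ => h.
have {}h : exists b, `[< sat (ncons b e) p \/ sat (ncons b e) q >].
  by case: h => -[b h]; exists b; apply/asboolP; auto.
case: (ex_minnP h) => b /asboolP bh bmin.
have lt_b c : c < b -> ~ (sat (ncons c e) p \/ sat (ncons c e) q).
  by move=> lcb /asboolP/bmin; rewrite leqNgt lcb.
have [qb|nqb] := EM (sat (ncons b e) q).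
  by right; exists b; split=> // c /lt_b h' pc; apply: h'; left.
left; exists b; split=> [|c]; first by case: bh.
by rewrite ltnS leq_eqVlt => /orP[/eqP -> //|/lt_b h' qc]; apply: h'; right.
Qed.

(** Variable 0 is kept for the quantifier in front, variable 1 becomes the
    numeral of [m], and the remaining ones become 0, so that the quantified
    formula is a sentence whatever formula one starts from. *)
Definition closing (m : nat) : desc := d_cons (Var 0) (d_cons (num m) d_zero).
Definition at_num (p : form) (m : nat) : form := fsubst (den (closing m)) p.

Lemma sat_at_num a e p m :
  sat (ncons a e) (at_num p m) = sat (ncons a (ncons m (fun=> 0))) p.
Proof.
rewrite /at_num sat_subst; congr sat; apply: funext => -[|[|i]] //=.
by elim: m => //= m ->.
Qed.

Lemma tbound_subst k s t : (forall i, tbound k (s i)) -> tbound k (tsubst s t).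
Proof. by move=> bs; elim: t => //= [t -> u ->|t -> u ->]. Qed.

Lemma tbound_shift k t : tbound k t -> tbound k.+1 (tshift t).
Proof.
rewrite /tshift; elim: t => //= t IHt u IHu /andP[/IHt h /IHu h'];
  by rewrite h h'.
Qed.

Lemma fbound_subst k s p : (forall i, tbound k (s i)) -> fbound k (fsubst s p).
Proof.
elim: p k s => //= [t u|t u|p IHp q IHq|p IHp] k s bs; rewrite ?tbound_subst //.
  by rewrite IHp ?IHq.
by apply: IHp => -[|i] //=; apply: tbound_shift.
Qed.

Lemma fbound_at_num p m : fbound 1 (at_num p m).
Proof.
apply: fbound_subst => -[|[|i]] //=.
by elim: m.
Qed.

(** That PA proves the implication from [Ex p] to [Ex q] at [m], in the form of
    the inconsistency of its negation. *)
Definition refuted (p q : form) (m : nat) : Prop :=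
  prv (PA2 (Ex (at_num p m)) (All (Neg (at_num q m)))) Bot.

Definition refuted_graph (x : nat) : Prop :=
  exists p q m, refuted p q m /\ x = npair (npair (godel p) (godel q)) m.

Notation nclosing t := (npair 3 (npair (npair 0 0) (npair 3 (npair t (npair 2 0))))).
Notation nNeg p := (nImp p nBot).

Lemma Sigma1_refuted : Sigma1_set refuted_graph.
Proof.
rewrite /Sigma1_set.
apply: (@Sigma1_ext (fun e => exists a b m a' b' t, is_form a /\ is_form b /\
   e 0 = npair (npair a b) m /\ num_graph (npair m t) /\
   fsubst_graph (npair (nclosing t) (npair a a')) /\
   fsubst_graph (npair (nclosing t) (npair b b')) /\
   prv_graph (npair (npair (nNeg (nAll (nNeg a'))) (nAll (nNeg b'))) nBot)));
  last by sigma1.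
move=> e; split; last first.
  move=> [p [q [m [h E]]]]; exists (godel p), (godel q), m.
  exists (godel (at_num p m)), (godel (at_num q m)), (tgodel (num m)).
  split; first by exists p.
  split; first by exists q.
  split=> //; split; first by exists m.
  split; first exact/(fsubst_graphE (closing m)).
  split; first exact/(fsubst_graphE (closing m)).
  by exists (Ex (at_num p m)), (All (Neg (at_num q m))), Bot.
move=> [_ [_ [m [a' [b' [t [[p ->] [[q ->] [E [[m' h]]]]]]]]]]].
case: (npair_inj h) => <- ->.
move=> [/(fsubst_graphE (closing m)) -> [/(fsubst_graphE (closing m)) ->]].
move=> [c [d [r [h' /npair_inj[/npair_inj[Ec Ed] Er]]]]].
exists p, q, m; split=> //; rewrite /refuted.
have <- : c = Ex (at_num p m) by apply: godel_inj.
have <- : d = All (Neg (at_num q m)) by apply: godel_inj.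
by have <- : r = Bot by apply: godel_inj.
Qed.
#[local] Hint Resolve Sigma1_refuted : sigma1.

Lemma refuted_graphE p q m :
  refuted_graph (npair (npair (godel p) (godel q)) m) <-> refuted p q m.
Proof.
split=> [[p' [q' [m' [h /npair_inj[/npair_inj[/godel_inj -> /godel_inj ->] ->]]]]]|h] //.
by exists p, q, m.
Qed.

(** Otherwise the standard model would satisfy an inconsistent theory. *)
Lemma refuted_sound p q m : refuted p q m ->
  (exists b, sat (ncons b (ncons m (fun=> 0))) p) ->
  exists b, sat (ncons b (ncons m (fun=> 0))) q.
Proof.
move=> r [b pb]; apply: contrapT => nq.
have := soundness _ r (fun=> 0); apply=> e f [/PA_true //|[->|->]].
  by rewrite sat_Ex; exists b; rewrite sat_at_num.
by move=> c; rewrite /= sat_at_num => qc; apply: nq; exists c.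
Qed.

(** The diagonal argument: [p] and [q] define the disjoint sets of the
    codes for which the one or the other implication is proved first, and are
    applied to the code of the pair they form. *)
Theorem incomparable_Sigma1 : exists p q, [/\ Delta0 p, Delta0 q,
  fbound 1 p /\ fbound 1 q,
  ~ prv (PA2 (Ex p) (All (Neg q))) Bot & ~ prv (PA2 (Ex q) (All (Neg p))) Bot].
Proof.
have SP : Sigma1 (fun e => exists a b, e 0 = npair a b /\
    refuted_graph (npair (npair a b) (e 0))) by sigma1.
have SQ : Sigma1 (fun e => exists a b, e 0 = npair a b /\
    refuted_graph (npair (npair b a) (e 0))) by sigma1.
have [P [Q [[p dp pP] [q dq qQ] sub disj tot]]] := Sigma1_reduction SP SQ.
pose m := npair (godel p) (godel q); pose e0 := ncons m (fun=> 0).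
have nPQ : ~ (P e0 \/ Q e0) => [[Pm|Qm]|].
- have [a [b [/npair_inj[<- <-] /refuted_graphE]]] := (sub e0).1 Pm.
  by move=> /refuted_sound r; apply: (disj e0); split=> //; apply/qQ/r/pP.
- have [a [b [/npair_inj[<- <-] /refuted_graphE]]] := (sub e0).2 Qm.
  by move=> /refuted_sound r; apply: (disj e0); split=> //; apply/pP/r/qQ.
exists (at_num p m), (at_num q m); split; rewrite ?fbound_at_num //;
  try exact: Delta0_subst.
- move=> r; apply/nPQ/tot; left; exists (godel p), (godel q); split=> //.
  exact/refuted_graphE.
- move=> r; apply/nPQ/tot; right; exists (godel p), (godel q); split=> //.
  exact/refuted_graphE.
Qed.


(** * The family of theories *)

(** Axioms may be replaced by proofs of them. *)
Lemma prv_cut (T T' : set form) p :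
  (forall q, T q -> prv T' q) -> prv T p -> prv T' p.
Proof.
move=> TT'; elim=> {p}; try by constructor.
- exact: TT'.
- by move=> p q _ hpq _ hp; apply: prv_mp hpq hp.
Qed.

Lemma prv_exfalso T p : prv T Bot -> prv T p.
Proof.
by move=> h; apply: prv_mp (prv_DN _ p) _; apply: prv_mp (prv_K _ _ _) h.
Qed.

Lemma PA_sentence p : PA p -> sentence p.
Proof. by case. Qed.

Lemma hier_of_Delta0 G n p : Delta0 p -> hier G n p.
Proof.
move=> dp; elim: n G => [|n IHn] G; first exact: hier_Delta0.
exact/hier_dual/IHn.
Qed.

Lemma hier_Ex n p : 1 <= n -> Delta0 p -> hier Sigma n (Ex p).
Proof. by case: n => // n _ dp; apply: (hier_quant (hier_of_Delta0 Sigma n.+1 dp)). Qed.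

Lemma hier_All n p : 1 <= n -> Delta0 p -> hier Pi n (All p).
Proof. by case: n => // n _ dp; apply: (hier_quant (hier_of_Delta0 Pi n.+1 dp)). Qed.

Lemma re_ext (A B : set nat) : (forall x, A x <-> B x) -> re A -> re B.
Proof. by move=> AB [c cP]; exists c => x; rewrite -AB. Qed.

(** The theory of index [i] is the case where [H] says that [i] is in the halting
    set; the condition is a proposition since it is undecidable. *)
Definition PAif (H : Prop) (c d : form) : set form :=
  fun p => PA p \/ H /\ (p = c \/ p = d).

Lemma PAif_theory H c d : sentence c -> sentence d -> ~ prv (PA2 c d) Bot ->
  theory (PAif H c d).
Proof.
move=> sc sd con; split.
- by move=> p [/PA_sentence|[_ [->|->]]].
- apply: (@re_ext (fun x => is_PA x \/ is_listed (if `[< H >] then [:: c; d] else [::]) x)).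
    move=> x; split=> [[[p Pp ->]|[p ps ->]]|[p [Pp|[h pcd]] <-]].
    + by exists p => //; left.
    + exists p => //; right; move: ps; case: asboolP => // h /= [<-|[<-|//]]; split; auto.
    + by left; exists p.
    + right; exists p => //; rewrite asboolT //=; case: pcd => ->; auto.
  by apply: Sigma1_re; rewrite /Sigma1_set; sigma1.
- by move=> p [sp pp]; split=> //; apply: prv_cut pp => q Pq; apply: prv_ax; left.
- move=> h; apply: con; apply: prv_cut h => p [Pp|[_ pcd]]; apply: prv_ax.
    by left.
  by right; case: pcd => ->; [left|right].
Qed.

Theorem corollary6p10 (n : nat) (hn : 1 <= n) (Gamma : kind) :
  exists (T : nat -> set form) (U : set form),
    [/\ re_family T,
        theory U,
        exists X : set nat,
          ~ (common (hier (dual Gamma) n) T X `<=`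
             Th (U `|` \bigcup_(i in X) ThC (hier Gamma n) (T i)))
      & ~ exists X : set nat,
          re X /\
          ~ (common (hier (dual Gamma) n) T X `<=`
             Th (U `|` \bigcup_(i in X) ThC (hier Gamma n) (T i)))].
Proof.
have [p [q [dp dq [bp bq] con_pq con_qp]]] := incomparable_Sigma1.
have s_pq : sentence (Ex p) /\ sentence (All (Neg q)) by rewrite /sentence /= bp bq.
have s_qp : sentence (Ex q) /\ sentence (All (Neg p)) by rewrite /sentence /= bp bq.
pose T i := PAif (halting i) (Ex p) (All (Neg q)).
pose U := PAif True (Ex q) (All (Neg p)).
have conU : ~ prv U Bot.
  by case: (PAif_theory True s_qp.1 s_qp.2 con_qp).
have PA_U (V : set form) f : PA f -> prv (U `|` V) f.
  by move=> Pf; apply: prv_ax; left; left.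
have TU V i f : ~ halting i -> prv (T i) f -> prv (U `|` V) f.
  by move=> ni; apply: prv_cut => g [/PA_U|[/ni]].
(* [psi] is the member of Gamma and [theta] that of the dual class. *)
have [psi [theta [hpsi htheta]]] : exists psi theta,
    [/\ hier Gamma n psi, hier (dual Gamma) n theta,
        psi = Ex p \/ psi = All (Neg q) & theta = Ex p \/ theta = All (Neg q)].
  have hE := hier_Ex hn dp; have hA := hier_All hn (Delta0_Neg dq).
  by case: Gamma; [exists (Ex p), (All (Neg q))|exists (All (Neg q)), (Ex p)];
    split=> //; auto.
have T_halt f i : f = Ex p \/ f = All (Neg q) -> halting i -> T i f.
  by move=> Df hi; right.
have sD f : f = Ex p \/ f = All (Neg q) -> sentence f by case=> ->; case: s_pq.
(* U contains the negation of either sentence: [Ex p] is [Imp (All (Neg p)) Bot]. *)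
have UD V f : f = Ex p \/ f = All (Neg q) -> prv (U `|` V) f -> prv (U `|` V) Bot.
  have Ueq : prv (U `|` V) (Ex q) by apply: prv_ax; left; right; split=> //; left.
  have Uap : prv (U `|` V) (All (Neg p)) by apply: prv_ax; left; right; split=> //; right.
  by case=> -> h; [apply: prv_mp h Uap | apply: prv_mp Ueq h].
move=> Dpsi Dtheta; exists T, U; split.
- split=> [i|]; first exact: PAif_theory s_pq.1 s_pq.2 con_pq.
  apply: (@re_ext (fun x => exists i y, x = npair i y /\
    (is_PA y \/ halting i /\ is_listed [:: Ex p; All (Neg q)] y))).
    move=> x; split=> [[i [_ [-> [[f Pf ->]|[hi [f fs ->]]]]]]|[i [f [Tf ->]]]].
    + by exists i, f; split=> //; left.
    + exists i, f; split=> //; apply: T_halt => //.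
      by case: fs => [<-|[<-|//]]; auto.
    + exists i, (godel f); split=> //; case: Tf => [Pf|[hi Df]]; first by left; exists f.
      by right; split=> //; exists f => //=; case: Df => ->; auto.
  by apply: Sigma1_re; rewrite /Sigma1_set; sigma1.
- exact: PAif_theory s_qp.1 s_qp.2 con_qp.
(* The complement of the halting set satisfies the first condition. *)
- exists (~` halting) => sub.
  have [|_ h] := sub theta.
    split; first exact: sD.
    by move=> i /= /contrapT hi; do !split=> //; [exact: sD|exact/prv_ax/T_halt].
  apply: conU; rewrite -[U]setU0; apply: (UD _ theta) => //.
  by apply: prv_cut h => f [Uf|[i ni [_ [_ /TU]]]]; [by apply: prv_ax; left|apply].
(* No r.e. set does. *)
move=> [X [reX]]; apply=> f [sf cf]; split=> //.
set V := \bigcup_(i in X) _.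
have [[i Xi hi]|nXh] := EM (exists2 i, X i & halting i).
  apply: prv_exfalso; apply: (UD _ psi) => //; apply: prv_ax; right; exists i => //.
  by do !split=> //; [exact: sD|exact/prv_ax/T_halt].
(* [X] would otherwise be the complement of the halting set. *)
have [i [nXi ni]] : exists i, ~ X i /\ ~ halting i.
  apply: contrapT => nex; apply: halting_not_co_re.
  apply: re_ext reX => i; split=> [Xi hi|ni]; first by apply: nXh; exists i.
  by apply: contrapT => nXi; apply: nex; exists i.
by have [_ [_ /TU]] := cf i nXi; apply.
Qed.
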